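(* Let $\Gamma(z)=Cz+D$ ($z\in\mathbb{C}^n$) for some $C\in\mathcal{M}(n)$ with $\|C\|\le 1$ and $D\in\mathbb{C}^n$, such that $C_\Gamma$ is bounded on $F_\psi^2$. Then $C_\Gamma$ is self-adjoint on $F_\psi^2$ if and only if $$D=0\quad\text{and}\quad C^*=C.$$
   Context: Let $n\ge 1$. On $\mathbb{C}^n$ write $\langle w,z\rangle=\sum_{j=1}^n w_j\overline{z_j}$ and $|w|^2=\langle w,w\rangle$. $\mathcal{M}(n)$ is the set of complex $n\times n$ matrices, $\|C\|$ is the operator norm of $C$ induced by $|\cdot|$, and $C^*$ is the conjugate transpose. Weight: $\psi:[0,\infty)\to[0,\infty)$ is a $C^3$ function with $\psi'(y)>0$, $\psi''(y)\ge 0$, $\psi'''(y)\ge 0$ for all $y\ge 0$. Moreover there is a real number $l<\tfrac12$ such that, with $\phi(y)=y\psi'(y)$, $\phi''(y)=O\big(y^{-1/2}[\phi'(y)]^{1+l}\big)$ as $y\to\infty$; when $n>1$ it is also assumed that $\psi''(y)=O\big(y^{-1/2}[\psi'(y)]^{1+l}\big)$ as $y\to\infty$. Space: $F_\psi^2$ is the Hilbert space of holomorphic functions $g:\mathbb{C}^n\to\mathbb{C}$ with $\int_{\mathbb{C}^n}|g(z)|^2e^{-\psi(|z|^2)}\,d\mu(z)<\infty$, with inner product $\langle g,h\rangle_\psi=\int_{\mathbb{C}^n} g(z)\overline{h(z)}e^{-\psi(|z|^2)}\,d\mu(z)$, where $\mu$ is Lebesgue measure on $\mathbb{C}^n$.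 For a holomorphic map $\Gamma:\mathbb{C}^n\to\mathbb{C}^n$, the composition operator is $C_\Gamma f=f\circ\Gamma$. ''Bounded on $F_\psi^2$'' means that the operator maps $F_\psi^2$ into itself and is a bounded linear operator. *)

(* Defs.v *)
From HB Require Import structures.
From mathcomp Require Import all_boot all_order all_algebra.
From mathcomp Require Import all_classical all_reals all_analysis.
From mathcomp Require Import complex.
Set Implicit Arguments.
Unset Strict Implicit.
Unset Printing Implicit Defensive.
Import Order.TTheory GRing.Theory Num.Theory.
Import numFieldNormedType.Exports.
Local Open Scope classical_set_scope.
Local Open Scope ring_scope.
Local Open Scope complex_scope.

(* Derivatives on the closed half-line [0, +oo[: the difference quotient is
   taken along [0, +oo[ only, hence the derivative at 0 is one-sided and the
   values of f on the negative reals are irrelevant. *)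
Section half_line.
Variable R : realType.
Implicit Types f : R -> R.

Definition hl_quotient f (y : R) : R -> R := fun x => (f x - f y) / (x - y).

Definition hl_derivable f : Prop := forall y : R, 0 <= y ->
  cvg (hl_quotient f y x @[x --> within `[0, +oo[ y^']).

Definition hl_deriv f : R -> R := fun y =>
  lim (hl_quotient f y x @[x --> within `[0, +oo[ y^']).

Definition hl_C3 f : Prop :=
  [/\ hl_derivable f, hl_derivable (hl_deriv f),
      hl_derivable (hl_deriv (hl_deriv f)) &
      {within `[0, +oo[, continuous (hl_deriv (hl_deriv (hl_deriv f)))}].

Definition at_pinfty : filter_on R := FilterType (pinfty_nbhs R) _.

Definition growth_condition (l : R) (f1 f2 : R -> R) : Prop :=
  f2 =O_ at_pinfty (fun y => y `^ (- 2^-1) * f1 y `^ (1 + l)).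

Record admissible_weight (n : nat) (psi : R -> R) : Prop := {
  weight_ge0 : forall y, 0 <= y -> 0 <= psi y;
  weight_C3 : hl_C3 psi;
  weight_deriv_gt0 : forall y, 0 <= y -> 0 < hl_deriv psi y;
  weight_deriv2_ge0 : forall y, 0 <= y -> 0 <= hl_deriv (hl_deriv psi) y;
  weight_deriv3_ge0 : forall y, 0 <= y ->
    0 <= hl_deriv (hl_deriv (hl_deriv psi)) y;
  weight_growth : exists l : R, [/\ l < 2^-1,
    let phi := fun y => y * hl_deriv psi y in
      growth_condition l (hl_deriv phi) (hl_deriv (hl_deriv phi)) &
    (1 < n)%N -> growth_condition l (hl_deriv psi) (hl_deriv (hl_deriv psi))]
}.

End half_line.

Section lebesgue_tuple.
Variable R : realType.
Local Notation mR := (measurableTypeR R).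

Definition tuple_cons m (p : mR * m.-tuple mR) : m.+1.-tuple mR :=
  [tuple of p.1 :: p.2].

Lemma measurable_tuple_cons m :
  measurable_fun [set: mR * m.-tuple mR] (@tuple_cons m).
Proof. exact: measurable_cons. Qed.

HB.instance Definition _ m :=
  isMeasurableFun.Build _ _ _ _ (@tuple_cons m) (@measurable_tuple_cons m).

Section lebesgue_cons.
Variables (m : nat) (mu : {measure set (m.-tuple mR) -> \bar R}).

Definition lebesgue_cons : set (m.+1.-tuple mR) -> \bar R :=
  pushforward (lebesgue_measure \x^ mu)%E (@tuple_cons m).

Let lebesgue_cons0 : lebesgue_cons set0 = 0%E.
Proof. exact: measure0. Qed.

Let lebesgue_cons_ge0 A : (0 <= lebesgue_cons A)%E.
Proof. exact: measure_ge0. Qed.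

Let lebesgue_cons_sigma_additive : semi_sigma_additive lebesgue_cons.
Proof. exact: measure_semi_sigma_additive. Qed.

HB.instance Definition _ := isMeasure.Build _ _ _ lebesgue_cons
  lebesgue_cons0 lebesgue_cons_ge0 lebesgue_cons_sigma_additive.

End lebesgue_cons.

(* Lebesgue measure on R^m, as an iterated product of measures *)
Fixpoint lebesgue_tuple (m : nat) : {measure set (m.-tuple mR) -> \bar R} :=
  match m with
  | 0 => \d_ ([tuple] : 0.-tuple mR)
  | m'.+1 => lebesgue_cons (lebesgue_tuple m')
  end.

End lebesgue_tuple.

Section complex_space.
Variables (R : realType) (n : nat).
Local Notation C := R[i].
Local Notation Cn := 'cV[C]_n.

Definition cdot (w z : Cn) : C := \sum_(j < n) w j 0 * conjc (z j 0).

Definition cnorm (w : Cn) : R := Num.sqrt (complex.Re (cdot w w)).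

Definition opnorm (M : 'M[C]_n) : R :=
  sup [set cnorm (M *m z) | z in [set z | cnorm z <= 1]].

Definition conj_transpose (M : 'M[C]_n) : 'M[C]_n :=
  map_mx conjc M^T.

(* The identification of R^(2n) with C^n: t is (x, y) and z = x + iy.
   Integrals over C^n are integrals over R^(n + n) along this map. *)
Definition Cn_of (t : (n + n).-tuple (measurableTypeR R)) : Cn :=
  \col_(j < n) (tnth t (lshift n j) +i* tnth t (rshift n j)).

(* The cast to numFieldType makes the normed C-module structures of C and C^n
   available; differentiability is thus Frechet differentiability over C. *)
Definition holomorphic (f : Cn -> C) : Prop :=
  let K : numFieldType := R[i] in
  forall z : 'cV[K]_n, differentiable (f : 'cV[K]_n -> K) z.

Section fock_space.
Variable psi : R -> R.

Definition weight (z : Cn) : R := expR (- psi (cnorm z ^+ 2)).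

Definition fock (g : Cn -> C) : Prop :=
  holomorphic g /\
  (\int[lebesgue_tuple R (n + n)]_t
     (Normc.normc (g (Cn_of t)) ^+ 2 * weight (Cn_of t))%:E < +oo)%E.

Definition fock_dot (g h : Cn -> C) : C :=
  let F t := g (Cn_of t) * conjc (h (Cn_of t)) * (weight (Cn_of t))%:C in
  (\int[lebesgue_tuple R (n + n)]_t complex.Re (F t)) +i*
  (\int[lebesgue_tuple R (n + n)]_t complex.Im (F t)).

Definition fock_norm (g : Cn -> C) : R :=
  Num.sqrt (complex.Re (fock_dot g g)).

Definition bounded_operator (T : (Cn -> C) -> (Cn -> C)) : Prop :=
  [/\ forall g, fock g -> fock (T g),
      forall (a : C) g h, fock g -> fock h ->
        T (fun z => a * g z + h z) = (fun z => a * T g z + T h z) &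
      exists K : R, forall g, fock g -> fock_norm (T g) <= K * fock_norm g].

Definition is_adjoint (T S : (Cn -> C) -> (Cn -> C)) : Prop :=
  [/\ bounded_operator T, bounded_operator S &
      forall g h, fock g -> fock h -> fock_dot (T g) h = fock_dot g (S h)].

Definition self_adjoint (T : (Cn -> C) -> (Cn -> C)) : Prop :=
  is_adjoint T T.

End fock_space.

Definition composition_operator (Gamma : Cn -> Cn) : (Cn -> C) -> (Cn -> C) :=
  fun f => f \o Gamma.

End complex_space.

(* Main.v *)
Require Import Defs.
From HB Require Import structures.
From mathcomp Require Import all_boot all_order fingroup perm all_algebra.
From mathcomp Require Import all_classical all_reals all_analysis.
From mathcomp Require Import complex.
From mathcomp Require Import measurable_realfun ring lra.
Set Implicit Arguments.
Unset Strict Implicit.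
Unset Printing Implicit Defensive.
Import Order.TTheory GRing.Theory Num.Theory.
Import numFieldNormedType.Exports.
Local Open Scope classical_set_scope.
Local Open Scope ring_scope.
Local Open Scope complex_scope.

(** The constant 1 and the coordinate functions lie in the Fock space, and they
    are pairwise orthogonal because changing the sign of one coordinate, or
    exchanging two of them, preserves both the measure and the weight.  Testing
    self-adjointness on them gives [D = 0] and [C^* = C].

    Conversely, diagonalizing a Hermitian contraction [C] in an orthonormal
    basis writes it as a product of commuting matrices [E r = 1 + (r - 1) P],
    with [P] a rank one projection and [-1 <= r <= 1], so it suffices to treat
    [E r].  For [r = -1] this is invariance under isometries.  For
    [0 <= r <= 1], averaging over the isometries [E (e^(i t))] reduces the
    claim to entire functions [F] and [H] of one variable, for which Cauchy's
    theorem yields that the integrals over [0 <= t <= 2 pi] of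
    [F (r e^(i t)) * conj (H (e^(i t)))] and
    [F (e^(i t)) * conj (H (r e^(i t)))] coincide. *)

(** * Invariance of Lebesgue measure on tuples *)

(** The measure is an iterated product over real coordinates, so its invariance under unitary
    matrices has to be earned. It is obtained once, for additive norm-preserving maps, and then
    serves the sign changes, the exchanges, the reflections [E (-1)] and the circles [E (e^(i t))].
    Splitting [C] into factors creates an obligation: the symmetry of one factor is applied to
    functions already composed with others, so each factor must preserve the Fock space by itself.
    This is why a contraction inequality for the integrals of [|F|^2] over circles is proved next to
    the exchange of radii, from which it is derived. Averaging succeeds because [E (e^(i t))]
    commutes with [E r] and preserves the weight: along the orbit of [z] the weight factors out, and
    only the entire functions [u -> f (E u z)] and [u -> h (E u z)] remain. Holomorphy is mere
    differentiability, without continuity of the derivative; hence Cauchy's theorem is reached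
    through Goursat's subdivision, on rectangles in the logarithmic coordinate. *)

Section lebesgue_shift.
Variable R : realType.
Local Notation mR := (measurableTypeR R).
Local Notation leb := (@lebesgue_measure R).

Lemma measurable_shift (a : R) : measurable_fun setT (fun x : mR => x + a : mR).
Proof. by apply: measurable_funD => //; exact: measurable_cst. Qed.

(** Lebesgue measure is determined by its values on half-open intervals, and a translation pulls
    such an interval back to one of the same length. *)
Lemma lebesgue_shift (a : R) (A : set mR) : measurable A ->
  leb A = pushforward leb (fun x : mR => x + a : mR) A.
Proof.
pose f : mR -> mR := fun x => x + a.
have mf : measurable_fun setT f := measurable_shift a.
pose F := HB.pack_for {mfun mR >-> mR} f (isMeasurableFun.Build _ _ _ _ f mf).
apply: (@lebesgue_measure_unique R (pushforward leb F)) => X [[u v] _ <-].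
transitivity (leb `]u - a, v - a]%classic); last first.
  congr (leb _); apply/seteqP; split => x /=;
    by rewrite /F /f !in_itv /= ltrBlDr lerBrDr.
rewrite !lebesgue_measure_itv /= !lte_fin ltrD2r; case: ifP => // _.
by rewrite -!EFinB; congr (_%:E); ring.
Qed.

Lemma ge0_integral_lebesgue_shift (a : R) (g : mR -> \bar R) :
  measurable_fun setT g -> (forall x, 0 <= g x)%E ->
  (\int[leb]_x g (x + a)%R = \int[leb]_x g x)%E.
Proof.
move=> mg g0.
pose f : mR -> mR := fun x => x + a.
have mf : measurable_fun setT f := measurable_shift a.
pose F := HB.pack_for {mfun mR >-> mR} f (isMeasurableFun.Build _ _ _ _ f mf).
transitivity (\int[pushforward leb F]_x g x)%E.
  by rewrite ge0_integral_pushforward.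
by apply: eq_measure_integral => A mA _; exact: (esym (lebesgue_shift a mA)).
Qed.

End lebesgue_shift.

Section lebesgue_tuple_theory.
Variable R : realType.
Local Notation mR := (measurableTypeR R).
Local Notation leb := (@lebesgue_measure R).

(* A constant over which the measure structures of the fixpoint
   [lebesgue_tuple] can be registered. *)
Definition lebt (m : nat) : set (m.-tuple mR) -> \bar R := lebesgue_tuple R m.

HB.instance Definition _ m := Measure.copy (@lebt m) (lebesgue_tuple R m).

Lemma sigma_finite_lebt m : sigma_finite setT (@lebt m).
Proof.
elim: m => [|m [F UF Ffin]].
  exists (fun=> setT); first by rewrite bigcup_const.
  by move=> _; split=> //; rewrite /lebt /= diracE in_setT ltry.
have [G UG Gfin] := sigma_finiteT leb.
pose F' n := \bigcup_(k in `I_n) F k; pose G' n := \bigcup_(k in `I_n) G k.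
pose hd : m.+1.-tuple mR -> mR := fun t => tnth t ord0.
pose tl : m.+1.-tuple mR -> m.-tuple mR := fun t => [tuple of behead t].
have mhd : measurable_fun setT hd by exact: measurable_tnth.
have mtl : measurable_fun setT tl by exact: measurable_behead.
have hdE p : hd (tuple_cons p) = p.1 by [].
have tlE p : tl (tuple_cons p) = p.2 by apply: val_inj.
(* [dec] decodes a natural number into a pair of indices; numbers coding no pair get [(0, 0)], which
   is harmless for a cover. *)
pose dec n := odflt (0, 0)%N (unpickle n : option (nat * nat)).
exists (fun n => hd @^-1` G (dec n).1 `&` tl @^-1` F (dec n).2).
  apply/esym/seteqP; split=> // t _.
  have [k _ Fk] : (\bigcup_k F k) (tl t) by rewrite -UF.
  have [l _ Gl] : (\bigcup_k G k) (hd t) by rewrite -UG.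
  exists (pickle (l, k)) => //=.
  by rewrite /dec pickleK.
move=> n; have [mG oG] := Gfin (dec n).1; have [mF oF] := Ffin (dec n).2.
split.
  apply: measurableI.
    by rewrite -(setTI (hd @^-1` _)); apply: mhd.
  by rewrite -(setTI (tl @^-1` _)); apply: mtl.
rewrite /lebt /= /lebesgue_cons /pushforward.
set S := (X in product_measure2 _ _ X).
have -> : S = G (dec n).1 `*` F (dec n).2.
  apply/funext => p.
  by rewrite -[LHS]/(G _ (hd (tuple_cons p)) /\ F _ (tl (tuple_cons p))) tlE.
by rewrite product_measure2E// lte_mul_pinfty// ge0_fin_numE.
Qed.

HB.instance Definition _ m :=
  Measure_isSigmaFinite.Build _ _ _ (@lebt m) (@sigma_finite_lebt m).

Lemma ge0_integral_lebtS m (g : m.+1.-tuple mR -> \bar R) :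
  measurable_fun setT g -> (forall x, 0 <= g x)%E ->
  (\int[@lebt m.+1]_t g t =
   \int[@lebt m]_t \int[leb]_x g (tuple_cons (x, t)))%E.
Proof.
move=> mg g0.
have mg' : measurable_fun setT (g \o @tuple_cons R m).
  by apply: measurableT_comp => //; exact: measurable_tuple_cons.
rewrite -(fubini_tonelli2 (g \o @tuple_cons R m))//; last by move=> x; exact: g0.
transitivity (\int[leb \x^ @lebt m]_z (g \o @tuple_cons R m) z)%E.
  rewrite /lebt /= /lebesgue_cons.
  by rewrite ge0_integral_pushforward//; exact: measurable_tuple_cons.
(* [lebesgue_cons] is built on [\x^], whereas Tonelli was applied to [\x]. Both agree on rectangles,
   so uniqueness of the product of sigma-finite measures identifies them. *)
apply: eq_measure_integral => A mA _.
by apply/esym/product_measure_unique => //= *; rewrite product_measure2E.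
Qed.

Definition addt m (s t : m.-tuple mR) : m.-tuple mR :=
  [tuple tnth s i + tnth t i | i < m].

Lemma measurable_addt d (T : measurableType d) m (f g : T -> m.-tuple mR) :
  measurable_fun setT f -> measurable_fun setT g ->
  measurable_fun setT (fun x => addt (f x) (g x)).
Proof.
move=> /measurable_fun_tnthP mf /measurable_fun_tnthP mg.
apply/measurable_fun_tnthP => i.
rewrite (_ : _ \o _ = fun x => tnth (f x) i + tnth (g x) i).
  by apply: measurable_funD; [exact: mf | exact: mg].
by apply/funext => x /=; rewrite tnth_mktuple.
Qed.

(** Translation invariance in the first coordinate with the tail fixed, then induction applied to
    the inner integral as a function of the tail. *)
Lemma ge0_integral_lebt_shift m (v : m.-tuple mR) (g : m.-tuple mR -> \bar R) :
  measurable_fun setT g -> (forall x, 0 <= g x)%E ->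
  (\int[@lebt m]_t g (addt t v) = \int[@lebt m]_t g t)%E.
Proof.
elim: m => [|m IH] in v g *; move=> mg g0.
  by apply: eq_integral => t _; congr g; apply: eq_from_tnth => -[].
have addv w : measurable_fun setT (fun t => @addt m.+1 t w).
  by apply: measurable_addt => //; exact: measurable_cst.
rewrite !ge0_integral_lebtS//; last exact: (measurableT_comp mg).
have [w0 wE] : exists w : m.-tuple mR, forall x t,
    addt (tuple_cons (x, t)) v = tuple_cons (x + tnth v ord0, addt t w).
  exists [tuple tnth v (lift ord0 i) | i < m] => x t; apply/eq_from_tnth => i.
  rewrite tnth_mktuple; case: (unliftP ord0 i) => [j|] ->; rewrite ?tnth0//.
  by rewrite !tnthS !tnth_mktuple.
under eq_integral do under eq_integral do rewrite wE.
have mc t : measurable_fun setT (fun x : mR => g (tuple_cons (x, t))).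
  apply: (measurableT_comp mg); apply: (measurableT_comp (@measurable_tuple_cons R m)).
  by apply: measurable_fun_pair => //; exact: measurable_cst.
under eq_integral do
  rewrite (@ge0_integral_lebesgue_shift R _ (fun x : mR => g (tuple_cons (x, addt _ w0))))//.
pose h t := (\int[leb]_x g (tuple_cons (x, t)))%E.
apply: (IH w0 h) => [|t]; last by apply: integral_ge0.
apply: (measurable_fun_fubini_tonelli_G (g \o @tuple_cons R m)) => //=.
by apply: measurableT_comp => //; exact: measurable_tuple_cons.
Qed.

Lemma measurable_prod_tnth m (h : mR -> R) : measurable_fun setT h ->
  measurable_fun setT (fun t : m.-tuple mR => \prod_(i < m) h (tnth t i)).
Proof.
move=> mh; apply: measurable_prod => i _.
by apply: (measurableT_comp mh); exact: measurable_tnth.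
Qed.

(** Tonelli for functions with separated variables. It provides the Gaussian normalization, the
    decay bound behind the weight, and the volume of a cube. *)
Lemma integral_lebt_prod m (h : mR -> R) (c : R) : measurable_fun setT h ->
  (forall x, 0 <= h x) -> (\int[leb]_x (h x)%:E = c%:E)%E ->
  (\int[@lebt m]_t (\prod_(i < m) h (tnth t i))%:E = (c ^+ m)%:E)%E.
Proof.
move=> mh h0 hc; elim: m => [|m IH].
  rewrite expr0; under eq_integral do rewrite big_ord0.
  by rewrite integral_cst// mul1e; exact: diracT.
have mp k := @measurable_prod_tnth k h mh.
have p0 k (t : k.-tuple mR) : (0 <= (\prod_(i < k) h (tnth t i))%:E)%E.
  by rewrite lee_fin prodr_ge0.
rewrite ge0_integral_lebtS; [|apply/measurable_EFinP; exact (mp m.+1)|exact: p0].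
have E t : (\int[leb]_x (\prod_(i < m.+1) h (tnth (tuple_cons (x, t)) i))%:E
    = c%:E * (\prod_(i < m) h (tnth t i))%:E)%E.
  transitivity (\int[leb]_x ((h x)%:E * (\prod_(i < m) h (tnth t i))%:E))%E.
    apply: eq_integral => x _; rewrite big_ord_recl tnth0 -EFinM.
    by congr (_ * _)%:E; apply: eq_bigr => i _; rewrite tnthS.
  rewrite ge0_integralZr//; first by rewrite hc.
  - exact/measurable_EFinP.
  - by move=> *; rewrite lee_fin.
under eq_integral do rewrite E.
rewrite ge0_integralZl//.
- by rewrite IH -EFinM -exprS.
- by apply/measurable_EFinP; exact (mp m).
- by rewrite -hc; apply: integral_ge0 => *; rewrite lee_fin.
Qed.

End lebesgue_tuple_theory.

Section isometry_invariance.
Variable R : realType.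
Local Notation mR := (measurableTypeR R).
Local Notation leb := (@lebesgue_measure R).

Definition subt m (s t : m.-tuple mR) : m.-tuple mR :=
  [tuple tnth s i - tnth t i | i < m].

Lemma measurable_subt d (T : measurableType d) m (f g : T -> m.-tuple mR) :
  measurable_fun setT f -> measurable_fun setT g ->
  measurable_fun setT (fun x => subt (f x) (g x)).
Proof.
move=> /measurable_fun_tnthP mf /measurable_fun_tnthP mg.
apply/measurable_fun_tnthP => i.
rewrite (_ : _ \o _ = fun x => tnth (f x) i - tnth (g x) i).
  by apply: measurable_realfun.measurable_funB; [exact: mf | exact: mg].
by apply/funext => x /=; rewrite tnth_mktuple.
Qed.

Definition gausst m (t : m.-tuple mR) : R := \prod_(i < m) gauss_fun (tnth t i).

Lemma gausstE m (t : m.-tuple mR) :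
  gausst t = expR (- \sum_(i < m) tnth t i ^+ 2).
Proof. by rewrite -sumrN expR_sum. Qed.

(* Uniqueness of Haar measure, in the form needed: Tonelli and translation
   invariance give [gauss * (g o M) = (gauss o M^-1) * g] after integration,
   and the Gaussian is an even function of the norm. *)
Lemma ge0_integral_lebt_isometry m (M N : m.-tuple mR -> m.-tuple mR)
    (g : m.-tuple mR -> \bar R) :
  measurable_fun setT M -> measurable_fun setT N ->
  (forall s t, M (addt s t) = addt (M s) (M t)) -> cancel N M ->
  (forall t, \sum_(i < m) tnth (M t) i ^+ 2 = \sum_(i < m) tnth t i ^+ 2) ->
  measurable_fun setT g -> (forall x, 0 <= g x)%E ->
  (\int[@lebt R m]_t g (M t) = \int[@lebt R m]_t g t)%E.
Proof.
move=> mM mN MD NK Mnorm mg g0.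
pose mu := @lebt R m.
pose c : R := Num.sqrt pi ^+ m.
have c0 : 0 < c by rewrite exprn_gt0// sqrtr_gt0 pi_gt0.
have G0 t : (0 <= (@gausst m t)%:E)%E.
  by rewrite lee_fin prodr_ge0// => i _; exact: gauss_fun_ge0.
have mG : measurable_fun setT (fun t => (@gausst m t)%:E).
  apply/measurable_EFinP; apply: measurable_prod_tnth.
  exact: measurable_gauss_fun.
have intG : (\int[mu]_t (gausst t)%:E = c%:E)%E.
  apply: integral_lebt_prod; first exact: measurable_gauss_fun.
    exact: gauss_fun_ge0.
  exact: integralT_gauss.
have mgM : measurable_fun setT (g \o M) by apply: measurableT_comp.
have MB s t : M (subt s t) = subt (M s) (M t).
  have -> : M s = addt (M (subt s t)) (M t).
    rewrite -MD; congr M; apply: eq_from_tnth => i.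
    by rewrite !tnth_mktuple subrK.
  by apply: eq_from_tnth => i; rewrite !tnth_mktuple addrK.
have mfst : measurable_fun setT (@fst (m.-tuple mR) (m.-tuple mR)).
  exact: measurable_fst.
have msnd : measurable_fun setT (@snd (m.-tuple mR) (m.-tuple mR)).
  exact: measurable_snd.
have mid : measurable_fun setT (fun x : m.-tuple mR => x).
  exact: (@measurable_id _ (m.-tuple mR)).
have mGsub (v : m.-tuple mR) :
    measurable_fun setT (fun x => (gausst (subt x v))%:E).
  apply: (measurableT_comp mG); apply: measurable_subt; first exact: mid.
  exact: measurable_cst.
have subtK (x v : m.-tuple mR) : subt (addt x v) v = x.
  by apply: eq_from_tnth => i; rewrite !tnth_mktuple addrK.
have step1 : (c%:E * \int[mu]_y g (M y) =
    \int[mu]_x \int[mu]_y ((gausst x)%:E * g (addt (M y) x)))%E.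
  rewrite -intG -ge0_integralZr//; last by apply: integral_ge0.
  apply: eq_integral => x _.
  rewrite -ge0_integralZl//.
  have mx : measurable_fun setT (fun y => (gausst x)%:E * g (M y))%E.
    by apply: emeasurable_funM; first exact: measurable_cst.
  have px y : (0 <= (gausst x)%:E * g (M y))%E by exact: mule_ge0.
  rewrite -[LHS](ge0_integral_lebt_shift (N x) mx px).
  by apply: eq_integral => y _; rewrite MD NK.
have step2 y : (\int[mu]_x ((gausst x)%:E * g (addt (M y) x)) =
    \int[mu]_x ((gausst (subt x (M y)))%:E * g x))%E.
  have my : measurable_fun setT (fun x => (gausst (subt x (M y)))%:E * g x)%E.
    by apply: emeasurable_funM.
  have py x : (0 <= (gausst (subt x (M y)))%:E * g x)%E by exact: mule_ge0.
  rewrite -[RHS](ge0_integral_lebt_shift (M y) my py).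
  apply: eq_integral => x _; rewrite subtK; congr (_ * g _)%E.
  by apply: eq_from_tnth => i; rewrite !tnth_mktuple addrC.
have step3 x : (\int[mu]_y ((gausst (subt x (M y)))%:E * g x) = c%:E * g x)%E.
  (* [x - M y = M (N x - y)], [M] preserves the norm and the Gaussian is even, so [M] disappears and
     a translation by [N x] is left. *)
  have E y : gausst (subt x (M y)) = gausst (subt y (N x)).
    rewrite !gausstE; congr (expR (- _)).
    rewrite -{1}(NK x) -MB Mnorm; apply: eq_bigr => i _.
    by rewrite !tnth_mktuple -sqrrN opprB.
  under eq_integral do rewrite E.
  rewrite ge0_integralZr//; congr (_ * _)%E; rewrite -intG.
  rewrite -[LHS](ge0_integral_lebt_shift (N x) (mGsub (N x)) (fun=> G0 _)).
  by apply: eq_integral => y _; rewrite subtK.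
have : (c%:E * \int[mu]_y g (M y) = c%:E * \int[mu]_y g y)%E.
  rewrite step1.
  rewrite (fubini_tonelli (fun p => (gausst p.1)%:E * g (addt (M p.2) p.1))%E).
  - under eq_integral do rewrite step2.
    rewrite (fubini_tonelli
      (fun p => (gausst (subt p.2 (M p.1)))%:E * g p.2)%E).
    + under eq_integral do rewrite step3.
      by rewrite ge0_integralZl// lee_fin ltW.
    + apply: emeasurable_funM; last exact: (measurableT_comp mg).
      apply: (measurableT_comp mG); apply: measurable_subt => //.
      exact: (measurableT_comp mM).
    + by move=> p; apply: mule_ge0.
  - apply: emeasurable_funM; first exact: (measurableT_comp mG).
    apply: (measurableT_comp mg); apply: measurable_addt => //.
    exact: (measurableT_comp mM).
  - by move=> p; apply: mule_ge0.
move=> /(congr1 (fun z => (c^-1)%:E * z)%E).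
by rewrite !muleA -EFinM mulVf ?gt_eqF// !mul1e.
Qed.

End isometry_invariance.

(** * Goursat's lemma on rectangles *)

Section interval_integral.
Variable R : realType.
Local Notation leb := (@lebesgue_measure R).
Implicit Types (f g : R -> R) (a b c : R).

(** There is no orientation: the value is [0] when [b < a], which is why order hypotheses accompany
    the splitting and bounding lemmas. *)
Definition itv_int f a b : R := (\int[leb]_(x in `[a, b]) f x)%R.

Lemma integrable_itv f a b : continuous f -> leb.-integrable `[a, b] (EFin \o f).
Proof.
move=> cf; apply: continuous_compact_integrable; first exact: segment_compact.
exact: continuous_subspaceT.
Qed.

Lemma itv_intB f g a b : continuous f -> continuous g ->
  itv_int (fun x => f x - g x) a b = itv_int f a b - itv_int g a b.
Proof. by move=> cf cg; apply: RintegralB => //; exact: integrable_itv. Qed.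

Lemma itv_intD f g a b : continuous f -> continuous g ->
  itv_int (fun x => f x + g x) a b = itv_int f a b + itv_int g a b.
Proof. by move=> cf cg; apply: RintegralD => //; exact: integrable_itv. Qed.

Lemma itv_int_split f a b c : continuous f -> a <= b -> b <= c ->
  itv_int f a c = itv_int f a b + itv_int f b c.
Proof.
move=> cf ab bc.
have := @Rintegral_itvB R f (BLeft a) (BRight c) b (integrable_itv a c cf).
rewrite !bnd_simp ab bc => /(_ isT isT) /eqP; rewrite subr_eq => /eqP E.
rewrite /itv_int E addrC; congr (_ + _); rewrite Rintegral_itv_obnd_cbnd//.
by apply: integrableS (integrable_itv b c cf) => //; apply: subset_itvr;
  rewrite bnd_simp.
Qed.

Lemma itv_int_cst k a b : a <= b -> itv_int (fun=> k) a b = k * (b - a).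
Proof.
move=> ab; rewrite /itv_int Rintegral_cst//; congr (_ * _).
rewrite [X in fine X](lebesgue_measure_itv `[a, b]) /= lte_fin; case: ltP => [//|ba].
by have -> : a = b; [apply/le_anti; rewrite ab ba|rewrite subrr].
Qed.

Lemma itv_intB_cst f k a b : continuous f -> a <= b ->
  itv_int (fun x => f x - k) a b = itv_int f a b - k * (b - a).
Proof.
move=> cf ab; rewrite (@itv_intB f (fun=> k))// ?itv_int_cst// => ?.
exact: cvg_cst.
Qed.

Lemma itv_int_le f g a b : continuous f -> continuous g ->
  (forall x, a <= x <= b -> f x <= g x) -> itv_int f a b <= itv_int g a b.
Proof.
move=> cf cg fg; apply: le_Rintegral => //; try exact: integrable_itv.
Qed.

Lemma itv_int_bound f k a b : continuous f -> a <= b ->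
  (forall x, a <= x <= b -> `|f x| <= k) -> `|itv_int f a b| <= k * (b - a).
Proof.
move=> cf ab fk; rewrite ler_norml -mulNr -!itv_int_cst//.
by apply/andP; split; apply: itv_int_le => //;
  try (by move=> ?; exact: cvg_cst); move=> x /fk; rewrite ler_norml => /andP[].
Qed.

End interval_integral.

Lemma norm_sum4_lt (R : realType) (A B C D K : R) :
  `|A| < K -> `|B| < K -> `|C| < K -> `|D| < K -> `|A + B + C + D| < 4 * K.
Proof.
rewrite !ltr_norml => /andP[? ?] /andP[? ?] /andP[? ?] /andP[? ?].
by apply/andP; split; lra.
Qed.

Section goursat.
Variable R : realType.
Variables p q : R -> R -> R.

(** Differentiability of [f] at [(x0, y0)] with gradient [(a, b)], the error being measured in the
    l1 distance. *)
Definition affine_approx (f : R -> R -> R) (x0 y0 a b : R) := forall e : R, 0 < e ->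
  exists2 d : R, 0 < d & forall x y, `|x - x0| < d -> `|y - y0| < d ->
    `|f x y - f x0 y0 - (a * (x - x0) + b * (y - y0))| <=
      e * (`|x - x0| + `|y - y0|).

(** The shared [b] states [dp/dy = dq/dx]: the form [p dx + q dy] is closed at each point. Nothing
    is said about continuity of the partial derivatives, so Green's formula is out of reach and
    subdivision is used. *)
Hypothesis closed_pq : forall x0 y0, exists a b c,
  affine_approx p x0 y0 a b /\ affine_approx q x0 y0 b c.

Let approx_cvg f x0 y0 a b : affine_approx f x0 y0 a b ->
  {for x0, continuous (f^~ y0)} /\ {for y0, continuous (f x0)}.
Proof.
move=> /(_ 1 ltr01)[d d0 H].
have K0 (k : R) : 0 < `|k| + 1 by rewrite ltr_wpDl.
split; apply/cvgrPdist_le => e e0; near=> t.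
  have td : `|t - x0| < d by rewrite distrC; near: t; exact: cvgr_dist_lt.
  have te : `|t - x0| <= e / (`|a| + 1).
    by rewrite distrC; near: t; apply: cvgr_dist_le => //; exact: divr_gt0.
  have := H t y0 td; rewrite subrr normr0 => /(_ d0).
  rewrite mulr0 !addr0 mul1r => H1.
  rewrite distrC -[X in `|X|](subrK (a * (t - x0))).
  rewrite (le_trans (ler_normD _ _))// normrM.
  rewrite (le_trans (lerD H1 (lexx _)))// -{1}[`|t - x0|]mul1r -mulrDl.
  by rewrite addrC mulrC -ler_pdivlMr.
have td : `|t - y0| < d by rewrite distrC; near: t; exact: cvgr_dist_lt.
have te : `|t - y0| <= e / (`|b| + 1).
  by rewrite distrC; near: t; apply: cvgr_dist_le => //; exact: divr_gt0.
have := H x0 t; rewrite subrr normr0 => /(_ d0 td).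
rewrite mulr0 !add0r mul1r => H1.
rewrite distrC -[X in `|X|](subrK (b * (t - y0))).
rewrite (le_trans (ler_normD _ _))// normrM.
rewrite (le_trans (lerD H1 (lexx _)))// -{1}[`|t - y0|]mul1r -mulrDl.
by rewrite addrC mulrC -ler_pdivlMr.
Unshelve. all: by end_near. Qed.

Lemma goursat_cont_px y : continuous (p^~ y).
Proof. by move=> x; have [a [b [c [/approx_cvg[]]]]] := closed_pq x y. Qed.

Lemma goursat_cont_qy x : continuous (q x).
Proof. by move=> y; have [a [b [c [_ /approx_cvg[]]]]] := closed_pq x y. Qed.

(** Counterclockwise circulation of [p dx + q dy] around [[a, b] x [c, d]]. Opposite sides share one
    integrand so that the affine parts can be removed pointwise. *)
Let Q a b c d := itv_int (fun x => p x c - p x d) a b +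
  itv_int (fun y => q b y - q a y) c d.

Let cpB c d : continuous (fun x => p x c - p x d).
Proof. by move=> x; apply: cvgB; apply: goursat_cont_px. Qed.

Let cqB a b : continuous (fun y => q b y - q a y).
Proof. by move=> x; apply: cvgB; apply: goursat_cont_qy. Qed.

Let QE a b c d : Q a b c d = itv_int (p^~ c) a b - itv_int (p^~ d) a b +
  (itv_int (q b) c d - itv_int (q a) c d).
Proof.
by rewrite /Q !itv_intB //; move=> ?; (apply: goursat_cont_px || apply: goursat_cont_qy).
Qed.

Let Q_split a m b c n d : a <= m -> m <= b -> c <= n -> n <= d ->
  Q a b c d = Q a m c n + Q m b c n + Q a m n d + Q m b n d.
Proof.
move=> am mb cn nd; rewrite !QE.
rewrite !(@itv_int_split _ (p^~ _) a m b)//; try exact: goursat_cont_px.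
rewrite !(@itv_int_split _ (q _) c n d)//; try exact: goursat_cont_qy.
by ring.
Qed.

(** After replacing [p] and [q] by their affine approximations, the two pairs of sides contribute
    [- be * m * l] and [be * l * m], which cancel. Each difference of two sides has error at most
    [2 * (e / 2) * (l + m)], and integrating over lengths [l] and [m] gives the square. *)
Let Q_local (x0 y0 e : R) : 0 < e -> exists2 d : R, 0 < d & forall a c l m : R,
  0 <= l -> 0 <= m -> l + m < d -> a <= x0 <= a + l -> c <= y0 <= c + m ->
  `|Q a (a + l) c (c + m)| <= e * (l + m) ^+ 2.
Proof.
move=> e0; have e2 : 0 < e / 2 by rewrite divr_gt0.
have [al [be [ga [Hp Hq]]]] := closed_pq x0 y0.
have [d1 d10 {}Hp] := Hp _ e2; have [d2 d20 {}Hq] := Hq _ e2.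
exists (Num.min d1 d2); first by rewrite lt_min d10.
move=> a c l m l0 m0; rewrite lt_min => /andP[lm1 lm2] ax cy.
have X x : a <= x <= a + l -> `|x - x0| <= l.
  by move: ax => /andP[? ?] /andP[? ?]; rewrite ler_norml; apply/andP; split; lra.
have Y y : c <= y <= c + m -> `|y - y0| <= m.
  by move: cy => /andP[? ?] /andP[? ?]; rewrite ler_norml; apply/andP; split; lra.
have c1 : c <= c <= c + m by rewrite lexx lerDl.
have c2 : c <= c + m <= c + m by rewrite lexx lerDl m0.
have a1 : a <= a <= a + l by rewrite lexx lerDl.
have a2 : a <= a + l <= a + l by rewrite lexx lerDl l0.
have Bp x : a <= x <= a + l -> `|p x c - p x (c + m) - be * (- m)| <= e * (l + m).
  move=> xl.
  have xd : `|x - x0| < d1 by rewrite (le_lt_trans (X x xl))//; lra.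
  have h1 := Hp x c xd; have h2 := Hp x (c + m) xd.
  have md : m < d1 by lra.
  have {}h1 := h1 (le_lt_trans (Y _ c1) md); have {}h2 := h2 (le_lt_trans (Y _ c2) md).
  have k1 : e / 2 * (`|x - x0| + `|c - y0|) <= e / 2 * (l + m).
    by rewrite ler_pM2l// lerD ?X ?Y.
  have k2 : e / 2 * (`|x - x0| + `|c + m - y0|) <= e / 2 * (l + m).
    by rewrite ler_pM2l// lerD ?X ?Y.
  have {}h1 := le_trans h1 k1; have {}h2 := le_trans h2 k2.
  move: h1 h2; rewrite !ler_norml => /andP[h11 h12] /andP[h21 h22].
  by apply/andP; split; nra.
have Bq y : c <= y <= c + m -> `|q (a + l) y - q a y - be * l| <= e * (l + m).
  move=> yl.
  have yd : `|y - y0| < d2 by rewrite (le_lt_trans (Y y yl))//; lra.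
  have ld : l < d2 by lra.
  have h1 := Hq a y (le_lt_trans (X _ a1) ld) yd.
  have h2 := Hq (a + l) y (le_lt_trans (X _ a2) ld) yd.
  have k1 : e / 2 * (`|a - x0| + `|y - y0|) <= e / 2 * (l + m).
    by rewrite ler_pM2l// lerD ?X ?Y.
  have k2 : e / 2 * (`|a + l - x0| + `|y - y0|) <= e / 2 * (l + m).
    by rewrite ler_pM2l// lerD ?X ?Y.
  have {}h1 := le_trans h1 k1; have {}h2 := le_trans h2 k2.
  move: h1 h2; rewrite !ler_norml => /andP[h11 h12] /andP[h21 h22].
  by apply/andP; split; nra.
have ccst (k : R) : continuous (fun _ : R => k) by move=> ?; exact: cvg_cst.
have al' : a <= a + l by rewrite lerDl.
have cm' : c <= c + m by rewrite lerDl.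
have cB f k : continuous f -> continuous (fun x : R => f x - k : R).
  by move=> cf x; apply: cvgB; [exact: cf|exact: cvg_cst].
have := itv_int_bound (cB _ (be * - m) (@cpB c (c + m))) al' Bp.
have := itv_int_bound (cB _ (be * l) (@cqB a (a + l))) cm' Bq.
rewrite !itv_intB_cst// ![_ + _ - _]addrC !addKr.
rewrite /Q; set P := itv_int _ a _; set T := itv_int _ c _.
rewrite !ler_norml => /andP[h11 h12] /andP[h21 h22].
by apply/andP; split; lra.
Qed.

Lemma goursat a b c d : a <= b -> c <= d ->
  itv_int (p^~ c) a b - itv_int (p^~ d) a b +
  (itv_int (q b) c d - itv_int (q a) c d) = 0.
Proof.
move=> ab cd; rewrite -QE.
pose L := b - a; pose M := d - c.
have L0 : 0 <= L by rewrite subr_ge0.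
have M0 : 0 <= M by rewrite subr_ge0.
pose l k := L / 2 ^+ k; pose m k := M / 2 ^+ k.
have p2 k : 0 < 2 ^+ k :> R by rewrite exprn_gt0.
have l0 k : 0 <= l k by rewrite divr_ge0// ltW.
have m0 k : 0 <= m k by rewrite divr_ge0// ltW.
have lS k : l k = l k.+1 + l k.+1 by rewrite /l exprS; field; rewrite gt_eqF.
have mS k : m k = m k.+1 + m k.+1 by rewrite /m exprS; field; rewrite gt_eqF.
(* Invariant of the subdivision: the rectangle of generation [k] with lower left corner [s] still
   carries at least the fraction [4^-k] of the circulation. *)
pose big k (s : R * R) :=
  `|Q a b c d| / 4 ^+ k <= `|Q s.1 (s.1 + l k) s.2 (s.2 + m k)|.
(* Stated for every corner [s], with the trivial answer [s' = s] when [big] fails, so that [choice]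
   yields a total successor function. *)
have step k (s : R * R) : exists s' : R * R, [/\ s.1 <= s'.1 <= s.1 + l k.+1,
    s.2 <= s'.2 <= s.2 + m k.+1 & big k s -> big k.+1 s'].
  have q4 : `|Q a b c d| / 4 ^+ k = 4 * (`|Q a b c d| / 4 ^+ k.+1).
    by rewrite exprS; field; rewrite gt_eqF// exprn_gt0.
  have [bk|nbk] := pselect (big k s); last first.
    by exists s; split=> //; rewrite lexx lerDl ?l0 ?m0.
  pose l' := l k.+1; pose m' := m k.+1.
  have l'0 : 0 <= l' by exact: l0.
  have m'0 : 0 <= m' by exact: m0.
  have QS : Q s.1 (s.1 + l k) s.2 (s.2 + m k) =
      Q s.1 (s.1 + l') s.2 (s.2 + m') +
      Q (s.1 + l') (s.1 + l' + l') s.2 (s.2 + m') +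
      Q s.1 (s.1 + l') (s.2 + m') (s.2 + m' + m') +
      Q (s.1 + l') (s.1 + l' + l') (s.2 + m') (s.2 + m' + m').
    rewrite (_ : s.1 + l k = s.1 + l' + l'); last by rewrite (lS k) addrA.
    rewrite (_ : s.2 + m k = s.2 + m' + m'); last by rewrite (mS k) addrA.
    by apply: Q_split; rewrite lerDl.
  move: bk; rewrite /big q4 QS => bk.
  have [h1|h1] := leP (`|Q a b c d| / 4 ^+ k.+1) `|Q s.1 (s.1 + l') s.2 (s.2 + m')|.
    by exists s; split; rewrite ?lexx ?lerDl ?l0 ?m0.
  have [h2|h2] := leP (`|Q a b c d| / 4 ^+ k.+1)
      `|Q (s.1 + l') (s.1 + l' + l') s.2 (s.2 + m')|.
    by exists (s.1 + l', s.2); split; rewrite ?lexx ?lerDl ?andbT ?l0 ?m0.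
  have [h3|h3] := leP (`|Q a b c d| / 4 ^+ k.+1)
      `|Q s.1 (s.1 + l') (s.2 + m') (s.2 + m' + m')|.
    by exists (s.1, s.2 + m'); split; rewrite ?lexx ?lerDl ?andbT ?l0 ?m0.
  have [h4|h4] := leP (`|Q a b c d| / 4 ^+ k.+1)
      `|Q (s.1 + l') (s.1 + l' + l') (s.2 + m') (s.2 + m' + m')|.
    by exists (s.1 + l', s.2 + m'); split; rewrite ?lexx ?lerDl ?andbT ?l0 ?m0.
  exfalso; move: bk; apply/negP; rewrite -ltNge.
  exact: norm_sum4_lt.
have [F HF] := choice (fun ks : nat * (R * R) => step ks.1 ks.2).
pose u := fix u k := if k is k'.+1 then F (k', u k') else (a, c).
have uS k := HF (k, u k).
have bigu k : big k (u k).
  elim: k => [|k IH]; last by have [_ _] := uS k; apply.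
  by rewrite /big /= /l /m !expr0 !divr1 /L /M !subrKC.
have mono1 k j : (u k).1 <= (u (k + j)%N).1 /\
    (u (k + j)%N).1 + l (k + j)%N <= (u k).1 + l k.
  elim: j => [|j [IH1 IH2]]; first by rewrite addn0.
  have [/andP[/= s1 s2] _ _] := uS (k + j)%N; rewrite addnS.
  have := lS (k + j)%N; rewrite /= => lE.
  by split; lra.
have mono2 k j : (u k).2 <= (u (k + j)%N).2 /\
    (u (k + j)%N).2 + m (k + j)%N <= (u k).2 + m k.
  elim: j => [|j [IH1 IH2]]; first by rewrite addn0.
  have [_ /andP[/= s1 s2] _] := uS (k + j)%N; rewrite addnS.
  have := mS (k + j)%N; rewrite /= => lE.
  by split; lra.
(* Nested intervals: the supremum of the left endpoints lies in all of them. *)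
have limit (v w : nat -> R) : (forall k, 0 <= w k) ->
    (forall k j, v k <= v (k + j)%N /\ v (k + j)%N + w (k + j)%N <= v k + w k) ->
    exists x, forall k, v k <= x <= v k + w k.
  move=> w0 vw; exists (sup (range v)) => k.
  have ub j i : v i <= v j + w j.
    have [vi _] := vw i j; have [_ vj] := vw j i.
    by rewrite addnC in vi; have := w0 (j + i)%N; lra.
  apply/andP; split.
    by apply: ub_le_sup; [exists (v k + w k) => _ [i _ <-]; exact: ub|exists k].
  by apply: ge_sup; [exists (v k), k|move=> _ [i _ <-]; exact: ub].
have [x0 Hx0] := limit (fun k => (u k).1) l l0 mono1.
have [y0 Hy0] := limit (fun k => (u k).2) m m0 mono2.
apply/eqP; rewrite -normr_le0 leNgt; apply/negP => Q0.
(* The local estimate is used with [e = |Q| / S]. It gives [|Q| <= e * (L + M)^2], and the [+ 1]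
   makes this contradictory while keeping [S] positive. *)
pose S := (L + M) ^+ 2 + 1.
have S0 : 0 < S by rewrite ltr_wpDl// sqr_ge0.
have [de de0 Hde] := Q_local x0 y0 (divr_gt0 Q0 S0).
have [k Hk] : exists k, l k + m k < de.
  have [k] : exists k : nat, (L + M) / de < k%:R.
    by exists (Num.trunc ((L + M) / de)).+1; rewrite truncnS_gt.
  rewrite ltr_pdivrMr// => Hk; exists k.
  rewrite /l /m -mulrDl ltr_pdivrMr// (lt_le_trans Hk)// mulrC ler_pM2l//.
  by rewrite -natrX ler_nat ltnW// ltn_expl.
have := Hde _ _ _ _ (l0 k) (m0 k) Hk (Hx0 k) (Hy0 k).
move=> /(le_trans (bigu k)).
rewrite /l /m -mulrDl expr_div_n -exprM mulnC exprM (_ : 2 ^+ 2 = 4 :> R); last by ring.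
rewrite mulrA ler_pM2r ?invr_gt0 ?exprn_gt0// -mulrA -[leLHS]mulr1 ler_pM2l//.
by rewrite mulrC ler_pdivlMr// mul1r /S => h; have := sqr_ge0 (L + M); lra.
Qed.

End goursat.

(** * Entire functions on circles *)

Section complex_calculus.
Variable R : realType.
Local Notation K := (R[i] : numFieldType).
Local Notation normc := Normc.normc.
Local Notation Re := complex.Re.
Local Notation Im := complex.Im.

Lemma normr_complexE (z : K) : `|z| = (normc z)%:C.
Proof. by []. Qed.

(** Radii of balls in [R[i]] are themselves complex, and [0 < e] in the partial order forces [e] to
    be real; convergence can therefore be tested with real radii. *)
Lemma cvg_normcP T (F : set_system T) {FF : Filter F} (f : T -> K) (a : K) :
  f @ F --> a <-> forall e : R, 0 < e -> \forall t \near F, normc (f t - a) < e.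
Proof.
split => [fa e e0|H].
  have e0' : 0 < e%:C :> K by rewrite ltcR.
  move/cvgrPdist_lt : fa => /(_ _ e0'); apply: filterS => t.
  by rewrite distrC normr_complexE ltcR.
apply/cvgrPdist_lt => e; rewrite ltcE => /andP[/eqP /= Ie Re0].
apply: filterS (H _ Re0) => t; rewrite distrC normr_complexE.
by rewrite ltcE /= Ie eqxx.
Qed.

Lemma nbhs_normcP (u0 : K) (P : set K) : nbhs u0 P <->
  exists2 d : R, 0 < d & forall u, normc (u - u0) < d -> P u.
Proof.
split => [/nbhs_normP[d /= d0 HP]|[d d0 HP]].
  move: d0 HP; rewrite ltcE => /andP[/eqP Id d0] HP; exists (complex.Re d) => // u ud.
  by apply: HP; rewrite /= distrC normr_complexE ltcE Id eqxx.
apply/nbhs_normP; exists (d%:C); first by rewrite /= ltcR.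
by move=> u /=; rewrite distrC => ud; apply: HP; rewrite -ltcR -normr_complexE.
Qed.

Lemma normr_Re_le (z : K) : `|Re z| <= normc z.
Proof. by rewrite -lecR -normr_complexE; exact: normc_ge_Re. Qed.

Lemma normr_Im_le (z : K) : `|Im z| <= normc z.
Proof.
case: z => x y /=; rewrite -sqrtr_sqr ler_wsqrtr// lerDr sqr_ge0//.
Qed.

Lemma normc_conj (z : K) : normc (conjc z) = normc z.
Proof. by case: z => x y /=; rewrite sqrrN. Qed.

Lemma conjcD (x y : R[i]) : conjc (x + y) = conjc x + conjc y.
Proof. exact: rmorphD. Qed.

Lemma conjcM (x y : R[i]) : conjc (x * y) = conjc x * conjc y.
Proof. exact: rmorphM. Qed.

Lemma conjc_sum (I : Type) (s : seq I) (F : I -> R[i]) :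
  conjc (\sum_(i <- s) F i) = \sum_(i <- s) conjc (F i).
Proof. exact: (big_morph _ conjcD (conjc0 R)). Qed.

Lemma real_complexM (x y : R) : (x * y)%:C = x%:C * y%:C.
Proof. exact: rmorphM. Qed.

Lemma real_complexN (x : R) : (- x)%:C = - x%:C.
Proof. exact: rmorphN. Qed.

Lemma normc_real (x : R) : normc (x%:C) = `|x|.
Proof. by rewrite /= expr0n addr0 sqrtr_sqr. Qed.

Lemma normc_ge0 (z : K) : 0 <= normc z.
Proof. by case: z => x y; exact: sqrtr_ge0. Qed.

Lemma sqr_normcE (z : K) : normc z ^+ 2 = Re (z * conjc z).
Proof.
case: z => x y /=; rewrite sqr_sqrtr; last by rewrite addr_ge0// sqr_ge0.
by rewrite mulrN opprK !expr2.
Qed.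

Section cvg.
Context (T : Type) (F : set_system T) {FF : Filter F}.
Implicit Types f g : T -> K.

Lemma cvgcM f g (a b : K) : f @ F --> a -> g @ F --> b ->
  (fun t => f t * g t) @ F --> a * b.
Proof. by move=> fa gb; exact: (@cvgM K T F FF f g a b fa gb). Qed.

Lemma cvgcD f g (a b : K) : f @ F --> a -> g @ F --> b ->
  (fun t => f t + g t) @ F --> a + b.
Proof. by move=> fa gb; exact: (@cvgD K K T F FF f g a b fa gb). Qed.

Lemma cvg_Re f (a : K) : f @ F --> a -> (fun t => Re (f t)) @ F --> Re a.
Proof.
move=> /cvg_normcP H; apply/cvgrPdist_lt => e /H; apply: filterS => t.
by rewrite distrC -raddfB; apply: le_lt_trans (normr_Re_le _).
Qed.

Lemma cvg_Im f (a : K) : f @ F --> a -> (fun t => Im (f t)) @ F --> Im a.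
Proof.
move=> /cvg_normcP H; apply/cvgrPdist_lt => e /H; apply: filterS => t.
by rewrite distrC -raddfB; apply: le_lt_trans (normr_Im_le _).
Qed.

Lemma cvg_conjc f (a : K) : f @ F --> a -> (fun t => conjc (f t) : K) @ F --> (conjc a : K).
Proof.
move=> /cvg_normcP H; apply/cvg_normcP => e /H; apply: filterS => t.
by rewrite -raddfB normc_conj.
Qed.

Lemma cvg_real_complex (f : T -> R) (a : R) :
  f @ F --> a -> (fun t => (f t)%:C : K) @ F --> (a%:C : K).
Proof.
move=> /cvgrPdist_lt H; apply/cvg_normcP => e /H; apply: filterS => t.
by rewrite -raddfB normc_real distrC.
Qed.

End cvg.

End complex_calculus.

(** * Differentiability in Carathéodory form and polar coordinates *)

Section caratheodory.
Variable R : realType.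
Local Notation K := (R[i] : numFieldType).
Local Notation normc := Normc.normc.
Local Notation Re := complex.Re.
Local Notation Im := complex.Im.
Implicit Types (F H : R[i] -> R[i]) (G : R * R -> R[i]).

(** Carathéodory's form of complex differentiability at each point: [phi] is the difference
    quotient, extended continuously. Chain and product rules become algebraic identities. *)
Definition entire F := forall u0 : K, exists phi : K -> K,
  phi u @[u --> u0] --> phi u0 /\ forall u, F u = F u0 + (u - u0) * phi u.

(** The same device in two real variables: [G] is differentiable at [z0] with partial derivatives
    [a] and [b]. *)
Definition has_partials G (z0 : R * R) (a b : R[i]) :=
  exists A B : R * R -> K,
  [/\ A z @[z --> z0] --> (a : K), B z @[z --> z0] --> (b : K) &
    forall z, G z = G z0 + (z.1 - z0.1)%:C * A z + (z.2 - z0.2)%:C * B z].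

Lemma cvg_fst_sub (z0 : R * R) : ((z.1 - z0.1)%:C : K) @[z --> z0] --> (0 : K).
Proof.
rewrite (_ : (0 : K) = (z0.1 - z0.1)%:C); last by rewrite subrr.
by apply: cvg_real_complex; apply: cvgB; [exact: cvg_fst|exact: cvg_cst].
Qed.

Lemma cvg_snd_sub (z0 : R * R) : ((z.2 - z0.2)%:C : K) @[z --> z0] --> (0 : K).
Proof.
rewrite (_ : (0 : K) = (z0.2 - z0.2)%:C); last by rewrite subrr.
by apply: cvg_real_complex; apply: cvgB; [exact: cvg_snd|exact: cvg_cst].
Qed.

Lemma has_partials_cvg G z0 a b : has_partials G z0 a b ->
  (G z : K) @[z --> z0] --> (G z0 : K).
Proof.
move=> [A [B [cA cB GE]]].
rewrite (_ : (G z0 : K) = G z0 + 0 * a + 0 * b); last by rewrite !mul0r !addr0.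
under eq_cvg do rewrite GE.
exact: (cvgcD (cvgcD (cvg_cst _) (cvgcM (cvg_fst_sub z0) cA))
  (cvgcM (cvg_snd_sub z0) cB)).
Qed.

Lemma has_partials_eq G z0 a b a' b' : has_partials G z0 a b ->
  a = a' -> b = b' -> has_partials G z0 a' b'.
Proof. by move=> ? <- <-. Qed.

Lemma has_partials_cst (k : R[i]) z0 : has_partials (fun=> k) z0 0 0.
Proof.
exists (fun=> 0), (fun=> 0); split; [exact: cvg_cst|exact: cvg_cst|move=> z].
by rewrite !mulr0 !addr0.
Qed.

Lemma has_partialsD G1 G2 z0 a1 b1 a2 b2 :
  has_partials G1 z0 a1 b1 -> has_partials G2 z0 a2 b2 ->
  has_partials (fun z => G1 z + G2 z) z0 (a1 + a2) (b1 + b2).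
Proof.
move=> [A1 [B1 [cA1 cB1 E1]]] [A2 [B2 [cA2 cB2 E2]]].
exists (fun z => A1 z + A2 z), (fun z => B1 z + B2 z).
split; [exact: (cvgcD cA1 cA2)|exact: (cvgcD cB1 cB2)|move=> z].
by rewrite E1 E2; ring.
Qed.

Lemma has_partialsM G1 G2 z0 a1 b1 a2 b2 :
  has_partials G1 z0 a1 b1 -> has_partials G2 z0 a2 b2 ->
  has_partials (fun z => G1 z * G2 z) z0
    (a1 * G2 z0 + G1 z0 * a2) (b1 * G2 z0 + G1 z0 * b2).
Proof.
move=> [A1 [B1 [cA1 cB1 E1]]] h2; have cG2 := has_partials_cvg h2.
move: h2 => [A2 [B2 [cA2 cB2 E2]]].
exists (fun z => A1 z * G2 z + G1 z0 * A2 z), (fun z => B1 z * G2 z + G1 z0 * B2 z).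
split.
- exact: (cvgcD (cvgcM cA1 cG2) (cvgcM (cvg_cst _) cA2)).
- exact: (cvgcD (cvgcM cB1 cG2) (cvgcM (cvg_cst _) cB2)).
- by move=> z; rewrite E1 E2; ring.
Qed.

Lemma has_partials_conj G z0 a b : has_partials G z0 a b ->
  has_partials (fun z => conjc (G z)) z0 (conjc a) (conjc b).
Proof.
move=> [A [B [cA cB E]]]; exists (fun z => conjc (A z)), (fun z => conjc (B z)).
split; [exact: (cvg_conjc cA)|exact: (cvg_conjc cB)|move=> z].
by rewrite E !conjcD !conjcM !conjc_real.
Qed.

(** The value [d = F'(G z0)] can stay existential: both partials are multiplied by the same number,
    which is all that the Cauchy-Riemann relation between them requires. *)
Lemma has_partials_comp F G z0 a b : entire F -> has_partials G z0 a b ->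
  exists d, has_partials (fun z => F (G z)) z0 (a * d) (b * d).
Proof.
move=> /(_ (G z0))[phi [cphi FE]] h; have cG := has_partials_cvg h.
move: h => [A [B [cA cB E]]]; exists (phi (G z0)).
have cphiG : phi (G z) @[z --> z0] --> phi (G z0).
  by apply: (cvg_comp G phi); [exact: cG|exact: cphi].
exists (fun z => A z * phi (G z)), (fun z => B z * phi (G z)).
split; [exact: (cvgcM cA cphiG)|exact: (cvgcM cB cphiG)|move=> z].
rewrite FE (_ : G z - G z0 = (z.1 - z0.1)%:C * A z + (z.2 - z0.2)%:C * B z).
  by ring.
by rewrite (E z); ring.
Qed.

Lemma has_partials_fst (f : R -> R) (z0 : R * R) (df : R) : is_derive z0.1 1 f df ->
  has_partials (fun z => (f z.1)%:C) z0 df%:C 0.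
Proof.
move=> /is_derive1_caratheodory[g [gE cg <-]].
exists (fun z => (g z.1)%:C), (fun=> 0); split.
- apply: cvg_real_complex; apply: (cvg_comp fst g); first exact: cvg_fst.
  exact: cg.
- exact: cvg_cst.
- move=> z; rewrite mulr0 addr0 -rmorphM -rmorphD mulrC -gE.
  by rewrite addrC subrK.
Qed.

Lemma has_partials_snd (f : R -> R) (z0 : R * R) (df : R) : is_derive z0.2 1 f df ->
  has_partials (fun z => (f z.2)%:C) z0 0 df%:C.
Proof.
move=> /is_derive1_caratheodory[g [gE cg <-]].
exists (fun=> 0), (fun z => (g z.2)%:C); split.
- exact: cvg_cst.
- apply: cvg_real_complex; apply: (cvg_comp snd g); first exact: cvg_snd.
  exact: cg.
- move=> z; rewrite mulr0 addr0 -rmorphM -rmorphD mulrC -gE.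
  by rewrite addrC subrK.
Qed.

Definition cis (t : R) : R[i] := cos t +i* sin t.

Lemma cisE t : cis t = (cos t)%:C + 'i%C * (sin t)%:C.
Proof. by apply/eqP; rewrite eq_complex /=; simpc; rewrite ?eqxx. Qed.

(** With [w = x + i y], the choice [s = 1] is [e^w], and [s = -1] is [e^(- conj w)], whose conjugate
    is holomorphic in [w]. *)
Lemma has_partials_polar (s : R) (z0 : R * R) : let E z := (expR (s * z.1))%:C * cis z.2 in
  has_partials E z0 (s%:C * E z0) ('i%C * E z0).
Proof.
move=> E.
have d1 : is_derive z0.1 1 (fun x => expR (s * x)) (s * expR (s * z0.1)).
  by apply: is_derive_eq; rewrite /GRing.scale /= mulr1 mulrC.
have h1 := has_partials_fst d1.
have h2 := @has_partials_snd cos z0 _ (is_derive_cos _).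
have h3 := @has_partials_snd sin z0 _ (is_derive_sin _).
have h4 := has_partialsD h2 (has_partialsM (has_partials_cst 'i%C z0) h3).
have := has_partialsM h1 h4.
rewrite (_ : (fun z => _) = E); last first.
  by apply/funext => z; rewrite /E cisE.
move=> /has_partials_eq; apply; rewrite /E cisE.
  by rewrite real_complexM; ring.
rewrite real_complexN.
transitivity ((expR (s * z0.1))%:C *
    ('i%C * (cos z0.2)%:C + 'i%C * 'i%C * (sin z0.2)%:C)); last by ring.
by rewrite -expr2 sqr_i; ring.
Qed.

(** The error of the affine approximation is [(x - x0) * (A z - a) + (y - y0) * (B z - b)], small by
    continuity of [A] and [B]. This is the link to the Goursat section. *)
Lemma affine_approx_Re_Im G (z0 : R * R) a b : has_partials G z0 a b ->
  affine_approx (fun x y => Re (G (x, y))) z0.1 z0.2 (Re a) (Re b) /\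
  affine_approx (fun x y => Im (G (x, y))) z0.1 z0.2 (Im a) (Im b).
Proof.
move=> [A [B [cA cB GE]]].
have key (P : R[i] -> R) : {morph P : x y / x + y} ->
    (forall k z, P (k%:C * z) = k * P z) ->
    (P (A z) @[z --> z0] --> P a) -> (P (B z) @[z --> z0] --> P b) ->
    affine_approx (fun x y => P (G (x, y))) z0.1 z0.2 (P a) (P b).
  move=> PD PM PA PB e e0.
  have : \forall z \near z0, `|P a - P (A z)| < e /\ `|P b - P (B z)| < e.
    by apply: filterI; [move/cvgrPdist_lt : PA; apply|move/cvgrPdist_lt : PB; apply].
  move=> /nbhs_ballP[d /= d0 Hd]; exists d => // x y xd yd.
  have [/ltW hA /ltW hB] : `|P a - P (A (x, y))| < e /\ `|P b - P (B (x, y))| < e.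
    by apply: Hd; split; rewrite /ball /= distrC.
  rewrite (GE (x, y)) -(surjective_pairing z0) !PD !PM /=.
  rewrite [X in `|X| <= _](_ : _ = - ((x - z0.1) * (P a - P (A (x, y))) +
    (y - z0.2) * (P b - P (B (x, y))))); last by ring.
  rewrite normrN (le_trans (ler_normD _ _))// !normrM mulrDr.
  by rewrite ![e * _]mulrC lerD// ler_wpM2l.
split; apply: key.
- by case=> [? ?] [? ?].
- by move=> k [x y] /=; rewrite mul0r subr0.
- exact: (cvg_Re cA).
- exact: (cvg_Re cB).
- by case=> [? ?] [? ?].
- by move=> k [x y] /=; rewrite mul0r addr0.
- exact: (cvg_Im cA).
- exact: (cvg_Im cB).
Qed.

End caratheodory.

(** * Exchange of radii and contraction for integrals over circles *)

Section circle.
Variable R : realType.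
Local Notation K := (R[i] : numFieldType).
Local Notation normc := Normc.normc.
Local Notation Re := complex.Re.
Local Notation Im := complex.Im.
Implicit Types (F H : R[i] -> R[i]).

Lemma entire_cvg F (u0 : K) : entire F -> (F u : K) @[u --> u0] --> (F u0 : K).
Proof.
move=> /(_ u0)[phi [cphi FE]].
rewrite (_ : (F u0 : K) = F u0 + 0 * phi u0); last by rewrite mul0r addr0.
under eq_cvg do rewrite FE.
have c0 : (u - u0 : K) @[u --> u0] --> (0 : K).
  apply/(cvg_normcP (F := nbhs (u0 : K)) (fun u => u - u0 : K) 0) => e e0.
  by apply/nbhs_normcP; exists e => // u; rewrite subr0.
exact: (cvgcD (cvg_cst _) (cvgcM c0 cphi)).
Qed.

Lemma entire_scale F (k : R[i]) : entire F -> entire (fun u => F (k * u)).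
Proof.
move=> eF u0; have [phi [cphi FE]] := eF (k * u0).
exists (fun u => k * phi (k * u)); split.
  have ck : (phi (k * u) : K) @[u --> (u0 : K)] --> (phi (k * u0) : K).
    apply: (cvg_comp (fun u : K => k * u) phi); last exact: cphi.
    exact: (@mulrl_continuous K k u0).
  exact: (cvgcM (cvg_cst _) ck).
by move=> u; rewrite FE; ring.
Qed.

Lemma normc_cis t : normc (cis t : R[i]) = 1.
Proof. by rewrite /cis /= cos2Dsin2 sqrtr1. Qed.

Lemma cis0 : cis 0 = 1 :> R[i].
Proof. by rewrite /cis cos0 sin0. Qed.

Lemma cis2pi : cis (2 * pi) = 1 :> R[i].
Proof. by rewrite /cis mulr_natl cos2pi sin2pi. Qed.

Lemma cvg_cis (t0 : R) : (cis t : K) @[t --> t0] --> (cis t0 : K).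
Proof.
under eq_cvg do rewrite cisE.
rewrite cisE; apply: (cvgcD (cvg_real_complex _)); first exact: continuous_cos.
by apply: (cvgcM (cvg_cst _)); apply: cvg_real_complex; exact: continuous_sin.
Qed.

Lemma continuous_circle F H (r s : R[i]) : entire F -> entire H ->
  continuous (fun t => Re (F (r * cis t) * conjc (H (s * cis t)))).
Proof.
move=> eF eH t0; apply: cvg_Re.
have c (k : R[i]) G : entire G ->
    (G (k * cis t) : K) @[t --> t0] --> (G (k * cis t0) : K).
  have ck : (k * cis t : K) @[t --> t0] --> (k * cis t0 : K).
    exact: (cvgcM (cvg_cst (k : K)) (@cvg_cis t0)).
  by move=> eG; apply: (cvg_comp (fun t => k * cis t : K) G ck); exact: entire_cvg.
exact: (cvgcM (c r F eF) (cvg_conjc (c s H eH))).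
Qed.

Lemma continuous_sqr_circle F (k : R[i]) : entire F ->
  continuous (fun t => normc (F (k * cis t)) ^+ 2).
Proof.
move=> eF; rewrite (_ : (fun t => _) =
  fun t => Re (F (k * cis t) * conjc (F (k * cis t)))).
  exact: continuous_circle.
by apply/funext => t; rewrite sqr_normcE.
Qed.

(** Goursat's lemma applied to [Im (G dw) = Im G dx + Re G dy] on [[a, b] x [0, 2 pi]]. The first
    hypothesis is the Cauchy-Riemann relation; periodicity cancels the two horizontal sides. *)
Lemma conformal_circle (G : R * R -> R[i]) (a b : R) :
  (forall z, exists d, has_partials G z d ('i%C * d)) ->
  (forall x, G (x, 0) = G (x, 2 * pi)) -> a <= b ->
  itv_int (fun t => Re (G (a, t))) 0 (2 * pi) =
  itv_int (fun t => Re (G (b, t))) 0 (2 * pi).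
Proof.
move=> dG G2pi ab.
have closed x0 y0 : exists al be ga,
    affine_approx (fun x y => Im (G (x, y))) x0 y0 al be /\
    affine_approx (fun x y => Re (G (x, y))) x0 y0 be ga.
  have [d /affine_approx_Re_Im /= [hR hI]] := dG (x0, y0).
  exists (Im d), (Re d), (Re ('i%C * d)); split => //.
  by case: d hI {hR} => u v /=; simpc.
have p0 : 0 <= 2 * pi :> R by rewrite mulr_ge0// pi_ge0.
have := goursat closed ab p0.
rewrite (_ : (fun x => Im (G (x, 0))) = (fun x => Im (G (x, 2 * pi)))); last first.
  by apply/funext => x; rewrite G2pi.
by rewrite subrr add0r => /eqP; rewrite subr_eq0 => /eqP.
Qed.

(* [G (x, y) = F (e^w) * conj (H (r * e^(- conj w)))] with [w = x + i y] is
   holomorphic in [w]; moving the contour from [x = 0] to [x = ln r] exchanges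
   the two radii. *)
Lemma circle_swap_gt0 F H (r : R) : entire F -> entire H -> 0 < r ->
  itv_int (fun t => Re (F (r%:C * cis t) * conjc (H (cis t)))) 0 (2 * pi) =
  itv_int (fun t => Re (F (cis t) * conjc (H (r%:C * cis t)))) 0 (2 * pi).
Proof.
move=> eF eH r0.
pose E (s : R) (z : R * R) := (expR (s * z.1))%:C * cis z.2.
pose G z := F (E 1 z) * conjc (H (r%:C * E (-1) z)).
have dG z : exists d, has_partials G z d ('i%C * d).
  have [d1 h1] := has_partials_comp eF (has_partials_polar 1 z).
  have [d2 h2] := has_partials_comp (entire_scale r%:C eH)
    (has_partials_polar (-1) z).
  eexists; apply: has_partials_eq (has_partialsM h1 (has_partials_conj h2)) _ _.
    by [].
  rewrite !conjcM real_complexN (_ : conjc 'i%C = - 'i%C :> R[i]); last first.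
    by apply/eqP; rewrite eq_complex /= oppr0 !eqxx.
  rewrite -!/(E _ _) (_ : conjc (- 1%:C) = - 1); last first.
    by apply/eqP; rewrite eq_complex /= !oppr0 !eqxx.
  by rewrite (_ : 1%:C = 1)//; ring.
have G2pi x : G (x, 0) = G (x, 2 * pi) by rewrite /G /E /= cis0 cis2pi.
have G0 t : G (0, t) = F (cis t) * conjc (H (r%:C * cis t)).
  by rewrite /G /E /= !mulr0 expR0 !mul1r.
have Gr t : G (ln r, t) = F (r%:C * cis t) * conjc (H (cis t)).
  rewrite /G /E /= mul1r mulN1r expRN lnK ?posrE// mulrA -real_complexM.
  by rewrite mulfV ?gt_eqF// mul1r.
have I0 : (fun t => Re (G (0, t))) =
    (fun t => Re (F (cis t) * conjc (H (r%:C * cis t)))).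
  by apply/funext => t; rewrite G0.
have Ir : (fun t => Re (G (ln r, t))) =
    (fun t => Re (F (r%:C * cis t) * conjc (H (cis t)))).
  by apply/funext => t; rewrite Gr.
have [r1|r1] := leP r 1.
  by have := conformal_circle dG G2pi (ln_le0 r1); rewrite I0 Ir.
by have := conformal_circle dG G2pi (ltW (ln_gt0 r1)); rewrite I0 Ir.
Qed.

(** Continuity at radius [0], where the coordinate [ln r] breaks down: [F (r e^(i t))] tends to
    [F 0] uniformly in [t], and [H] is bounded on the unit circle. *)
Lemma circle_cvg0 F H (e : R) : entire F -> entire H -> 0 < e ->
  exists2 d : R, 0 < d & forall r : R, 0 <= r < d ->
    `|itv_int (fun t => Re (F (r%:C * cis t) * conjc (H (cis t)))) 0 (2 * pi) -
      itv_int (fun t => Re (F (0%:C * cis t) * conjc (H (cis t)))) 0 (2 * pi)| <= e.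
Proof.
move=> eF eH e0.
have p0 : 0 < 2 * pi :> R by rewrite mulr_gt0// pi_gt0.
have cH : continuous (fun t => normc (H (cis t)) ^+ 2).
  rewrite (_ : (fun t => _) = fun t => normc (H (1 * cis t)) ^+ 2).
    exact: continuous_sqr_circle.
  by apply/funext => t; rewrite mul1r.
have [M Mge] : exists M, forall t, 0 <= t <= 2 * pi -> normc (H (cis t)) <= M.
  have [c _ Hc] := EVT_max (ltW p0) (continuous_subspaceT cH).
  exists (normc (H (cis c))) => t t2; rewrite -ler_sqr ?nnegrE ?normc_ge0//.
  by apply: Hc; rewrite in_itv.
pose M1 := `|M| + 1; have M10 : 0 < M1 by rewrite ltr_wpDl.
have e'0 : 0 < e / (M1 * (2 * pi)) by rewrite divr_gt0// mulr_gt0.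
have := entire_cvg (u0 := 0) eF; move=> /cvg_normcP /(_ _ e'0).
move=> /nbhs_normcP[d d0 Hd].
exists d => // r /andP[r0 rd].
have c1 := @continuous_circle F H _ 1 eF eH.
have E k : (fun t => Re (F (k * cis t) * conjc (H (cis t)))) =
    (fun t => Re (F (k * cis t) * conjc (H (1 * cis t)))).
  by apply/funext => t; rewrite mul1r.
rewrite !E -itv_intB; [|exact: c1|exact: c1].
rewrite -[e](divfK (lt0r_neq0 p0)) -[X in _ <= _ * X]subr0.
apply: itv_int_bound; [|exact: ltW|].
  by move=> x; apply: cvgB; exact: c1.
move=> t t2; rewrite -raddfB -mulrBl mul1r (le_trans (normr_Re_le _))//.
rewrite Normc.normcM normc_conj mul0r.
have : normc (F (r%:C * cis t) - F 0) < e / (M1 * (2 * pi)).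
  apply: Hd; rewrite subr0.
  by rewrite Normc.normcM normc_cis mulr1 normc_real ger0_norm.
move=> /ltW h; rewrite (_ : e / _ = e / (M1 * (2 * pi)) * M1).
  apply: ler_pM => //; rewrite ?normc_ge0// (le_trans (Mge _ t2))//.
  by rewrite (le_trans (ler_norm _))// lerDl.
have alg (u v : R) : 0 < u -> 0 < v -> e / u = e / (v * u) * v.
  by move=> u0 v0; field; rewrite !gt_eqF.
exact: alg.
Qed.

(** For [r = 0], both sides are compared with their values at a common small radius [r' > 0], each
    within [e / 2], and the positive case equates these two values. The symmetry [swap] lets
    [circle_cvg0] treat the right-hand side with [F] and [H] exchanged. *)
Lemma circle_swap F H (r : R) : entire F -> entire H -> 0 <= r ->
  itv_int (fun t => Re (F (r%:C * cis t) * conjc (H (cis t)))) 0 (2 * pi) =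
  itv_int (fun t => Re (F (cis t) * conjc (H (r%:C * cis t)))) 0 (2 * pi).
Proof.
move=> eF eH; rewrite le_eqVlt => /predU1P[<-|]; last exact: circle_swap_gt0.
have swap (r' : R) : (fun t => Re (F (cis t) * conjc (H (r'%:C * cis t)))) =
    (fun t => Re (H (r'%:C * cis t) * conjc (F (cis t)))).
  apply/funext => t; case: (F _) (H _) => u v [u' v'] /=.
  by ring.
apply/eqP; rewrite -subr_eq0 -normr_le0; apply/ler_addgt0Pr => e e0; rewrite add0r.
have e2 : 0 < e / 2 by rewrite divr_gt0.
have [d1 d10 H1] := circle_cvg0 eF eH e2.
have [d2 d20 H2] := circle_cvg0 eH eF e2.
pose r' := Num.min d1 d2 / 2.
have m0 : 0 < Num.min d1 d2 by rewrite lt_min d10.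
have r'0 : 0 < r' by rewrite divr_gt0.
have r'm : r' < Num.min d1 d2 by rewrite ltr_pdivrMr// ltr_pMr// ltrDl.
have [rd1 rd2] : r' < d1 /\ r' < d2 by apply/andP; rewrite -lt_min.
have := H2 r'; have := H1 r'; rewrite (ltW r'0) rd1 rd2 => /(_ isT) h1 /(_ isT) h2.
rewrite circle_swap_gt0// !swap in h1 *.
by move: h1 h2; rewrite !ler_norml => /andP[? ?] /andP[? ?]; apply/andP; split; lra.
Qed.

(* Let [a s] be the integral of [|F|^2] over the circle of radius [s].  By
   [circle_swap] and AM-GM, [2 a(s) <= a(1) + a(s^2)], hence
   [2^k (a(r) - a(1)) <= a(r^(2^k)) - a(1)], whose right-hand side is bounded. *)
Lemma circle_contraction F (r : R) : entire F -> 0 <= r <= 1 ->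
  itv_int (fun t => normc (F (r%:C * cis t)) ^+ 2) 0 (2 * pi) <=
  itv_int (fun t => normc (F (cis t)) ^+ 2) 0 (2 * pi).
Proof.
move=> eF /andP[r0 r1].
have p0 : 0 < 2 * pi :> R by rewrite mulr_gt0// pi_gt0.
pose a (s : R) := itv_int (fun t => normc (F (s%:C * cis t)) ^+ 2) 0 (2 * pi).
have cn (s : R) : continuous (fun t => normc (F (s%:C * cis t)) ^+ 2).
  exact: continuous_sqr_circle.
have a1 : itv_int (fun t => normc (F (cis t)) ^+ 2) 0 (2 * pi) = a 1.
  by congr itv_int; apply/funext => t; rewrite mul1r.
rewrite a1 -/(a r).
have half s : 0 <= s -> 2 * a s <= a 1 + a (s ^+ 2).
  move=> s0.
  (* [circle_swap] with [H u = F (s u)] moves one factor [s] across the pairing: the radii [s, s]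
     become [1, s^2]. *)
  have -> : a s = itv_int (fun t => Re (F (1%:C * cis t) *
      conjc (F ((s ^+ 2)%:C * cis t)))) 0 (2 * pi).
    rewrite (_ : (fun t => _) = (fun t => Re (F (cis t) *
      conjc (F (s%:C * (s%:C * cis t)))))); last first.
      by apply/funext => t; rewrite mul1r mulrA -real_complexM -expr2.
    rewrite -(circle_swap eF (entire_scale s%:C eF) s0) /a; congr itv_int.
    by apply/funext => t; rewrite sqr_normcE.
  have c11 := @continuous_circle F F 1%:C (s ^+ 2)%:C eF eF.
  rewrite mulr_natl mulr2n -!itv_intD//; try exact: cn.
  apply: itv_int_le.
  - by move=> t; apply: cvgD; exact: c11.
  - by move=> t; apply: cvgD; exact: cn.
  - move=> t _; move: (F (1%:C * cis t)) (F ((s ^+ 2)%:C * cis t)) => [u v] [u' v'].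
    rewrite !sqr_normcE /=; have := sqr_ge0 (u - u'); have := sqr_ge0 (v - v').
    by nra.
have iter k : 2 ^+ k * (a r - a 1) <= a (r ^+ (2 ^ k)) - a 1.
  elim: k => [|k IH]; first by rewrite expr0 mul1r.
  have := half _ (exprn_ge0 (2 ^ k) r0); rewrite -exprM -expnSr exprS => h.
  by lra.
have [->//|rn1] := eqVneq r 1.
have rlt1 : r < 1 by rewrite lt_neqAle rn1.
(* Bound for [a] near radius [0], from [|F| <= |F 0| + 1] and the length [2 pi] of the interval; the
   leading [2] is slack. *)
pose C := (2 * (normc (F 0) + 1) ^+ 2) * (2 * pi).
have [d d0 abnd] : exists2 d : R, 0 < d & forall s, 0 <= s < d ->
    a s <= C.
  have := entire_cvg (u0 := 0) eF; move=> /cvg_normcP /(_ _ ltr01).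
  move=> /nbhs_normcP[d d0 Hd2].
  exists d => // s /andP[s0 sd]; rewrite /C -[X in _ <= _ * X]subr0.
  apply: le_trans (ler_norm _) _; apply: itv_int_bound; [exact: cn|exact: ltW|].
  move=> t _; rewrite ger0_norm ?sqr_ge0//.
  have /ltW h : normc (F (s%:C * cis t) - F 0) < 1.
    apply: Hd2; rewrite subr0.
    by rewrite Normc.normcM normc_cis mulr1 normc_real ger0_norm.
  have h2 : normc (F (s%:C * cis t)) <= normc (F 0) + 1.
    rewrite -[X in normc X](subrK (F 0)) (le_trans (le_normcD _ _))//.
    by rewrite addrC lerD.
  apply: (@le_trans _ _ ((normc (F 0) + 1) ^+ 2)).
    by rewrite ler_sqr ?nnegrE ?addr_ge0 ?normc_ge0.
  by rewrite ler_peMl ?sqr_ge0// ler1n.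
rewrite leNgt; apply/negP => lt1.
have gt0 : 0 < a r - a 1 by rewrite subr_gt0.
have a10 : 0 <= a 1 by apply: Rintegral_ge0 => t _; exact: sqr_ge0.
have : \forall k \near \oo, r ^+ k < d.
  have : r ^+ k @[k --> \oo] --> (0 : R) by apply: cvg_expr; rewrite ger0_norm.
  move=> /cvgrPdist_lt /(_ _ d0); apply: filterS => k.
  by rewrite sub0r normrN ger0_norm ?exprn_ge0.
move=> [N _ HN].
(* Since [k < 2^k], this [k] is large enough both for [r^(2^k)] to fall below [d] and for
   [2^k (a(r) - a(1))] to exceed [C]. *)
pose k := maxn N (Num.trunc (C / (a r - a 1))).+1.
have Nk : (N <= 2 ^ k)%N.
  by rewrite (@leq_trans k) ?leq_maxl// ltnW// ltn_expl.
have h1 := abnd (r ^+ (2 ^ k)); rewrite exprn_ge0//= (HN _ Nk) in h1.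
have h2 := iter k; have {}h1 := h1 isT.
have : C < 2 ^+ k * (a r - a 1).
  rewrite -ltr_pdivrMr// (lt_le_trans (truncnS_gt _))// -natrX ler_nat.
  by rewrite (@leq_trans k) ?leq_maxr// ltnW// ltn_expl.
by move=> h3; have := lt_le_trans h3 (le_trans h2 (lerB h1 a10)); rewrite subr0 ltxx.
Qed.

End circle.

(** * Isometries of the complex space *)

Section measurability.
Context {R : realType} {d : measure_display} {T : measurableType d}.
Local Notation mR := (measurableTypeR R).

(* The sigma-algebra on tuples is generated by the projections, so a continuous
   function is obtained as a limit of step functions on the grids of mesh
   [1 / (k + 1)]. *)
Lemma measurable_fun_tuple_continuous m (g : m.-tuple mR -> R)
    (Z : T -> m.-tuple mR) :
  (forall t (e : R), 0 < e -> exists2 de : R, 0 < de &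
    forall s : m.-tuple mR, (forall i, `|tnth s i - tnth t i| < de) ->
      `|g s - g t| < e) ->
  measurable_fun setT Z -> measurable_fun setT (g \o Z).
Proof.
move=> cg mZ; apply: (measurableT_comp _ mZ) => {Z mZ}.
pose kap (k : nat) (t : m.-tuple mR) : m.-tuple int :=
  [tuple Num.floor (k.+1%:R * tnth t i) | i < m].
pose va (k : nat) (s : m.-tuple int) : m.-tuple mR :=
  [tuple (tnth s i)%:~R / k.+1%:R | i < m].
have k0 k : 0 < k.+1%:R :> R by rewrite ltr0n.
have mkap k s : measurable [set t | kap k t = s].
  rewrite (_ : [set t | _] =
    \bigcap_(i in [set: 'I_m]) [set t | Num.floor (k.+1%:R * tnth t i) = tnth s i]).
    apply: fin_bigcap_measurable => [|i _]; first exact: finite_finset.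
    pose I := `[(tnth s i)%:~R / k.+1%:R, (tnth s i + 1)%:~R / k.+1%:R[%classic : set mR.
    rewrite (_ : [set t | _] = setT `&` (fun t => tnth t i) @^-1` I).
      by apply: (@measurable_tnth _ mR m i) => //; exact: measurable_itv.
    have IE (x : R) : I x =
        ((tnth s i)%:~R <= k.+1%:R * x < (tnth s i + 1)%:~R) :> Prop.
      by rewrite /I /= in_itv /= ler_pdivrMr// ltr_pdivlMr// [x * _]mulrC.
    rewrite setTI; apply/seteqP; split => t; rewrite /preimage /mkset IE.
      by move=> <-; rewrite floor_itv// num_real.
    by move=> h; exact: floor_def.
  apply/seteqP; split => t /=; first by move=> <- i _ /=; rewrite tnth_mktuple.
  by move=> h; apply: eq_from_tnth => i; rewrite tnth_mktuple; exact: h.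
have mgk k : measurable_fun setT (fun t => g (va k (kap k t))).
  move=> _ B mB; rewrite setTI.
  rewrite (_ : _ @^-1` B = \bigcup_(s in [set: m.-tuple int])
      (if g (va k s) \in B then [set t | kap k t = s] else set0)).
    apply: countable_bigcupT_measurable => // s.
    by case: ifP => // _; exact: measurable0.
  apply/seteqP; split => [t Bt|t [s _]]; first by exists (kap k t); rewrite // mem_set.
  by case: ifPn => //; rewrite inE => Bs /= ->.
apply: (@measurable_fun_cvg _ _ _ _ (fun k t => g (va k (kap k t)))) => //.
move=> t _; apply/cvgrPdist_lt => e e0.
have [de de0 Hde] := cg t e e0.
near=> k; rewrite distrC; apply: Hde => i; rewrite !tnth_mktuple.
set x := tnth t i.
have kd : k.+1%:R^-1 < de by near: k; exact: near_infty_natSinv_lt (PosNum de0).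
apply: le_lt_trans kd.
have /andP[h1 h2] := floor_itv (k.+1%:R * x).
have xE : x = k.+1%:R * x / k.+1%:R by rewrite mulrAC mulfV ?mul1r ?gt_eqF.
rewrite [X in _ - X]xE -mulrBl normrM [X in _ * X]gtr0_norm ?invr_gt0//.
apply: ler_piMl; first by rewrite invr_ge0 ltW.
rewrite distrC ger0_norm ?subr_ge0//; apply/ltW.
by rewrite ltrBlDl; move: h2; rewrite intrD.
Unshelve. all: by end_near. Qed.

Definition cmeasurable (f : T -> R[i]) :=
  measurable_fun setT (fun x => complex.Re (f x)) /\
  measurable_fun setT (fun x => complex.Im (f x)).

Lemma cmeasurable_cst k : cmeasurable (fun=> k).
Proof. by split; exact: measurable_cst. Qed.

Lemma cmeasurableD f g : cmeasurable f -> cmeasurable g ->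
  cmeasurable (fun x => f x + g x).
Proof.
move=> [f1 f2] [g1 g2]; split.
  rewrite (_ : (fun x => _) = fun x => complex.Re (f x) + complex.Re (g x)).
    exact: measurable_realfun.measurable_funD.
  by apply/funext => x; rewrite raddfD.
rewrite (_ : (fun x => _) = fun x => complex.Im (f x) + complex.Im (g x)).
  exact: measurable_realfun.measurable_funD.
by apply/funext => x; rewrite raddfD.
Qed.

Lemma cmeasurableM f g : cmeasurable f -> cmeasurable g ->
  cmeasurable (fun x => f x * g x).
Proof.
move=> [f1 f2] [g1 g2]; split.
  rewrite (_ : (fun x => _) = fun x => complex.Re (f x) * complex.Re (g x) -
      complex.Im (f x) * complex.Im (g x)).
    by apply: measurable_realfun.measurable_funB;
      exact: measurable_realfun.measurable_funM.
  by apply/funext => x; case: (f x) => ? ?; case: (g x) => ? ?.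
rewrite (_ : (fun x => _) = fun x => complex.Re (f x) * complex.Im (g x) +
    complex.Im (f x) * complex.Re (g x)).
  by apply: measurable_realfun.measurable_funD;
    exact: measurable_realfun.measurable_funM.
by apply/funext => x; case: (f x) => ? ?; case: (g x) => ? ?.
Qed.

Lemma cmeasurable_conj f : cmeasurable f -> cmeasurable (fun x => conjc (f x)).
Proof.
move=> [f1 f2]; split.
  rewrite (_ : (fun x => _) = fun x => complex.Re (f x))//.
  by apply/funext => x; case: (f x).
rewrite (_ : (fun x => _) = fun x => - complex.Im (f x)).
  exact: measurable_realfun.measurable_funN.
by apply/funext => x; case: (f x).
Qed.

Lemma cmeasurable_sum (I : Type) (s : seq I) (F : I -> T -> R[i]) :
  (forall i, cmeasurable (F i)) -> cmeasurable (fun x => \sum_(i <- s) F i x).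
Proof.
move=> mF; elim: s => [|i s IH].
  by under [X in cmeasurable X]eq_fun do rewrite big_nil; exact: cmeasurable_cst.
under [X in cmeasurable X]eq_fun do rewrite big_cons.
by apply: cmeasurableD.
Qed.

Definition vmeasurable n (Z : T -> 'cV[R[i]]_n) :=
  forall j, cmeasurable (fun x => Z x j 0).

Lemma vmeasurable_mul n (A : T -> 'M[R[i]]_n) (Z : T -> 'cV[R[i]]_n) :
  (forall i j, cmeasurable (fun x => A x i j)) -> vmeasurable Z ->
  vmeasurable (fun x => A x *m Z x).
Proof.
move=> mA mZ j; under [X in cmeasurable X]eq_fun do rewrite mxE.
by apply: cmeasurable_sum => k; apply: cmeasurableM.
Qed.

End measurability.

Section complex_tuple.
Variables (R : realType) (n : nat).
Local Notation mR := (measurableTypeR R).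
Local Notation Cn := 'cV[R[i]]_n.
Local Notation normc := Normc.normc.

Definition tuple_of_Cn (z : Cn) : (n + n).-tuple mR :=
  [tuple match fintype.split i with
         | inl j => complex.Re (z j 0) | inr j => complex.Im (z j 0) end | i < n + n].

Lemma tnth_tuple_of_Cn_l z j : tnth (tuple_of_Cn z) (lshift n j) = complex.Re (z j 0).
Proof. by rewrite tnth_mktuple (unsplitK (inl j)). Qed.

Lemma tnth_tuple_of_Cn_r z j : tnth (tuple_of_Cn z) (rshift n j) = complex.Im (z j 0).
Proof. by rewrite tnth_mktuple (unsplitK (inr j)). Qed.

Lemma tuple_of_CnK : cancel tuple_of_Cn (@Cn_of R n).
Proof.
move=> z; apply/matrixP => j k; rewrite mxE ord1 tnth_tuple_of_Cn_l tnth_tuple_of_Cn_r.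
by case: (z j 0).
Qed.

Lemma Cn_ofK : cancel (@Cn_of R n) tuple_of_Cn.
Proof.
move=> t; apply: eq_from_tnth => i; rewrite -(splitK i); case: (fintype.split i) => j /=.
  by rewrite tnth_tuple_of_Cn_l mxE.
by rewrite tnth_tuple_of_Cn_r mxE.
Qed.

Lemma vmeasurable_Cn_of : vmeasurable (@Cn_of R n).
Proof.
move=> j; split.
  by under eq_fun do rewrite mxE; exact: measurable_tnth.
by under eq_fun do rewrite mxE; exact: measurable_tnth.
Qed.

Lemma measurable_tuple_of_Cn d (T : measurableType d) (Z : T -> Cn) :
  vmeasurable Z -> measurable_fun setT (fun x => tuple_of_Cn (Z x)).
Proof.
move=> mZ; apply/measurable_fun_tnthP => i.
rewrite -(splitK i); case: (fintype.split i) => j; have [m1 m2] := mZ j.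
  by under [X in measurable_fun _ X]eq_fun do rewrite /= tnth_tuple_of_Cn_l.
by under [X in measurable_fun _ X]eq_fun do rewrite /= tnth_tuple_of_Cn_r.
Qed.

Definition eps_continuous (g : Cn -> R) := forall (z : Cn) (e : R), 0 < e ->
  exists2 de : R, 0 < de &
    forall z' : Cn, (forall j, normc (z' j 0 - z j 0) < de) -> `|g z' - g z| < e.

Lemma measurable_eps_continuous d (T : measurableType d) (g : Cn -> R) (Z : T -> Cn) :
  eps_continuous g -> vmeasurable Z -> measurable_fun setT (fun x => g (Z x)).
Proof.
move=> cg mZ.
rewrite (_ : (fun x => _) = (g \o @Cn_of R n) \o (fun x => tuple_of_Cn (Z x))).
  apply: measurable_fun_tuple_continuous; last exact: measurable_tuple_of_Cn.
  move=> t e e0; have [de de0 H] := cg (Cn_of t) e e0.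
  exists (de / 2); first by rewrite divr_gt0.
  move=> s Hs; apply: H => j; rewrite !mxE.
  have h1 := Hs (lshift n j); have h2 := Hs (rshift n j).
  have le_sum (x y : R) : normc (x +i* y) <= `|x| + `|y|.
    have -> : x +i* y = x%:C + (0 +i* y) by simpc.
    rewrite (le_trans (le_normcD _ _))// normc_real lerD// /=.
    by rewrite expr0n add0r sqrtr_sqr.
  by apply: le_lt_trans (le_sum _ _) _; rewrite (splitr de) ltrD.
by apply/funext => x /=; rewrite tuple_of_CnK.
Qed.

Definition sqn (z : Cn) : R := \sum_(j < n) normc (z j 0) ^+ 2.

Lemma sqnE z : sqn z = \sum_(i < n + n) tnth (tuple_of_Cn z) i ^+ 2.
Proof.
rewrite big_split_ord /= -big_split /=; apply: eq_bigr => j _.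
rewrite tnth_tuple_of_Cn_l tnth_tuple_of_Cn_r; case: (z j 0) => x y /=.
by rewrite sqr_sqrtr// addr_ge0// sqr_ge0.
Qed.

Lemma sqn_ge0 z : 0 <= sqn z.
Proof. by apply: sumr_ge0 => j _; exact: sqr_ge0. Qed.

Lemma Re_cdot z : complex.Re (cdot z z) = sqn z.
Proof. by rewrite /cdot raddf_sum; apply: eq_bigr => j _; rewrite sqr_normcE. Qed.

Lemma sqr_cnorm z : cnorm z ^+ 2 = sqn z.
Proof. by rewrite /cnorm Re_cdot sqr_sqrtr// sqn_ge0. Qed.

(** The data consumed by [ge0_integral_lebt_isometry], transported to complex coordinates.
    Additivity takes the place of linearity, because the Gaussian argument only translates. *)
Record Cn_isometry (M : Cn -> Cn) : Prop := {
  isometryD : {morph M : x y / x + y};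
  isometry_surj : exists2 N : Cn -> Cn, cancel N M &
    forall Z : (n + n).-tuple mR -> Cn, vmeasurable Z -> vmeasurable (N \o Z);
  isometry_sqn : forall z, sqn (M z) = sqn z;
  isometry_meas : forall Z : (n + n).-tuple mR -> Cn, vmeasurable Z -> vmeasurable (M \o Z)
}.

Local Notation vol := (@lebt R (n + n)).

Lemma ge0_integral_isometry (M : Cn -> Cn) (g : Cn -> \bar R) : Cn_isometry M ->
  measurable_fun setT (fun t => g (Cn_of t)) -> (forall z, 0 <= g z)%E ->
  (\int[vol]_t g (M (Cn_of t)) = \int[vol]_t g (Cn_of t))%E.
Proof.
move=> [MD [N NK mN] Mn mM] mg g0.
pose M' t := tuple_of_Cn (M (Cn_of t)); pose N' t := tuple_of_Cn (N (Cn_of t)).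
have := @ge0_integral_lebt_isometry R (n + n) M' N' (fun t => g (Cn_of t)).
have -> : (fun t => g (M (Cn_of t))) = (fun t => g (Cn_of (M' t))).
  by apply/funext => t; rewrite /M' tuple_of_CnK.
apply=> //.
- exact/measurable_tuple_of_Cn/mM/vmeasurable_Cn_of.
- exact/measurable_tuple_of_Cn/mN/vmeasurable_Cn_of.
- move=> s t; rewrite /M'.
  have -> : Cn_of (addt s t) = Cn_of s + Cn_of t.
    by apply/matrixP => j k; rewrite !mxE !tnth_mktuple; simpc.
  rewrite MD; apply: eq_from_tnth => i; rewrite [RHS]tnth_mktuple.
  by rewrite -(splitK i); case: (fintype.split i) => j;
    rewrite ?tnth_tuple_of_Cn_l ?tnth_tuple_of_Cn_r mxE raddfD.
- by move=> t; rewrite /M' /N' tuple_of_CnK NK Cn_ofK.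
- by move=> t; rewrite -sqnE Mn sqnE Cn_ofK.
Qed.

Lemma integral_isometry (M : Cn -> Cn) (g : Cn -> \bar R) : Cn_isometry M ->
  measurable_fun setT (fun t => g (Cn_of t)) ->
  (\int[vol]_t g (M (Cn_of t)) = \int[vol]_t g (Cn_of t))%E.
Proof.
move=> iM mg; rewrite integralE [RHS]integralE; congr (_ - _)%E.
  under eq_integral do rewrite funeposE.
  under [RHS]eq_integral do rewrite funeposE.
  apply: (@ge0_integral_isometry M (fun z => maxe (g z) 0%E)) => // [|z].
    by apply: measurable_maxe => //; exact: measurable_cst.
  by rewrite le_max lexx orbT.
under eq_integral do rewrite funenegE.
under [RHS]eq_integral do rewrite funenegE.
apply: (@ge0_integral_isometry M (fun z => maxe (- g z) 0)%E) => // [|z].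
  apply: measurable_maxe; last exact: measurable_cst.
  exact: (measurableT_comp (@oppe_measurable R setT)).
by rewrite le_max lexx orbT.
Qed.

End complex_tuple.

(** * Averages over a circle of isometries *)

Section averaging.
Variables (R : realType) (n : nat).
Local Notation mR := (measurableTypeR R).
Local Notation Cn := 'cV[R[i]]_n.
Local Notation leb := (@lebesgue_measure R).
Local Notation vol := (@lebt R (n + n)).

Definition cn_measurable (q : Cn -> R) := measurable_fun setT (fun t => q (Cn_of t)).

Lemma cn_measurable_comp d (T : measurableType d) (q : Cn -> R) (Z : T -> Cn) :
  cn_measurable q -> vmeasurable Z -> measurable_fun setT (fun x => q (Z x)).
Proof.
move=> mq mZ.
rewrite (_ : (fun x => _) = (fun t => q (Cn_of t)) \o (fun x => tuple_of_Cn (Z x))).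
  exact: (measurableT_comp mq (measurable_tuple_of_Cn mZ)).
by apply/funext => x /=; rewrite tuple_of_CnK.
Qed.

Variable U : R -> Cn -> Cn.
Hypothesis isoU : forall th, Cn_isometry (U th).
Hypothesis mU : vmeasurable (fun p : mR * (n + n).-tuple mR => U p.1 (Cn_of p.2)).
Variable q : Cn -> R.
Hypothesis mq : cn_measurable q.
Hypothesis cq : forall z, continuous (fun th => q (U th z)).

Let D : set mR := `[0, 2 * pi]%classic.
(** The indicator makes integrals over [[0, 2 pi]] integrals over the whole line, so that the
    product-measure theorems apply directly. *)
Let k (p : mR * (n + n).-tuple mR) : R := \1_D p.1 * q (U p.1 (Cn_of p.2)).

Let mD : measurable D. Proof. exact: measurable_itv. Qed.

Let mk : measurable_fun setT k.
Proof.
have m1 : measurable_fun setT (\1_D : mR -> R) by exact: measurable_indic.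
apply: measurable_realfun.measurable_funM.
  exact: (measurableT_comp m1 measurable_fst).
exact: (cn_measurable_comp mq mU).
Qed.

Let mEk : measurable_fun setT (fun p => (k p)%:E).
Proof. exact/measurable_EFinP. Qed.

Let int_circle t : (\int[leb]_th (k (th, t))%:E =
  (itv_int (fun th => q (U th (Cn_of t))) 0 (2 * pi))%:E)%E.
Proof.
have ik := integrable_itv 0 (2 * pi) (cq (z := Cn_of t)).
rewrite /itv_int /Rintegral fineK; last exact: integrable_fin_num ik.
rewrite [RHS]integral_mkcond; apply: eq_integral => th _.
rewrite patchE /k /= indicE; case: ifP => _; first by rewrite mul1r.
by rewrite mul0r.
Qed.

Let lebD : leb D = (2 * pi)%:E.
Proof.
rewrite /D lebesgue_measure_itv /= lte_fin mulr_gt0 ?pi_gt0//.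
by rewrite oppr0 adde0.
Qed.

Let int_indic : (\int[leb]_th (\1_D th)%:E = (2 * pi)%:E)%E.
Proof. by rewrite integral_indic// setIT. Qed.

Let mI : measurable_fun setT (fun th : mR => (\1_D th : R)%:E).
Proof. by apply/measurable_EFinP; exact: measurable_indic. Qed.

Let pI (th : mR) : setT th -> (0 <= (\1_D th : R)%:E)%E.
Proof. by move=> _; rewrite lee_fin. Qed.

(** Each [U th] preserves the integral of [q]; integrating this over [th] and exchanging the
    integrals by Tonelli gives the average along orbits. *)
Lemma ge0_circle_average : (forall z, 0 <= q z) ->
  ((2 * pi)%:E * \int[vol]_t (q (Cn_of t))%:E =
   \int[vol]_t (itv_int (fun th => q (U th (Cn_of t))) 0 (2 * pi))%:E)%E.
Proof.
move=> q0.
have k0 p : (0 <= (k p)%:E)%E by rewrite lee_fin mulr_ge0.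
have mqE : measurable_fun setT (fun t => (q (Cn_of t))%:E) by exact/measurable_EFinP.
transitivity (\int[leb]_th \int[vol]_t (k (th, t))%:E)%E; last first.
  rewrite (fubini_tonelli (fun p => (k p)%:E) mEk k0).
  by apply: eq_integral => t _; exact: int_circle.
have I0 : (0 <= \int[vol]_t (q (Cn_of t))%:E)%E.
  by apply: integral_ge0 => t _; rewrite lee_fin.
rewrite -int_indic -(ge0_integralZr leb measurableT mI pI I0).
apply: eq_integral => th _.
rewrite -(ge0_integral_isometry (g := fun z => (q z)%:E) (isoU th) mqE); last first.
  by move=> z; rewrite lee_fin.
have mUq : measurable_fun setT (fun t => (q (U th (Cn_of t)))%:E).
  apply/measurable_EFinP; apply: (cn_measurable_comp (Z := fun t => U th (Cn_of t)) mq).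
  have [_ _ _] := isoU th; apply; exact: vmeasurable_Cn_of.
have pUq t : setT t -> (0 <= (q (U th (Cn_of t)))%:E)%E.
  by move=> _; rewrite lee_fin.
by rewrite -(ge0_integralZl vol measurableT mUq pUq (pI I)).
Qed.

Lemma measurable_circle_average : (forall z, 0 <= q z) ->
  measurable_fun setT
    (fun t => (itv_int (fun th => q (U th (Cn_of t))) 0 (2 * pi))%:E).
Proof.
move=> q0; have k0 p : (0 <= (k p)%:E)%E by rewrite lee_fin mulr_ge0.
apply: eq_measurable_fun (measurable_fun_fubini_tonelli_G (m1 := leb) _ mEk k0).
by move=> t _; exact: int_circle.
Qed.

(** Signed version, by Fubini. Joint integrability holds because, by invariance, the iterated
    integral of [|k|] is [2 pi] times the finite integral of [|q|]. *)
Lemma circle_average : vol.-integrable setT (fun t => (q (Cn_of t))%:E) ->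
  ((2 * pi)%:E * \int[vol]_t (q (Cn_of t))%:E =
   \int[vol]_t (itv_int (fun th => q (U th (Cn_of t))) 0 (2 * pi))%:E)%E.
Proof.
move=> iq.
have mqE : measurable_fun setT (fun t => (q (Cn_of t))%:E) by exact/measurable_EFinP.
have maE : measurable_fun setT (fun t => `|(q (Cn_of t))%:E|%E).
  exact: measurableT_comp.
have mUq th : measurable_fun setT (fun t => (q (U th (Cn_of t)))%:E).
  apply/measurable_EFinP; apply: (cn_measurable_comp (Z := fun t => U th (Cn_of t)) mq).
  have [_ _ _] := isoU th; apply; exact: vmeasurable_Cn_of.
have [_ iq'] := integrableP _ _ _ iq.
have fin_abs : (\int[vol]_t `|(q (Cn_of t))%:E| \is a fin_num)%E.
  by rewrite ge0_fin_numE// integral_ge0.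
have ik : (leb \x vol)%E.-integrable setT (fun p => (k p)%:E).
  apply/(integrable12ltyP _ _ mEk).
  rewrite (eq_integral (fun th => (\1_D th)%:E * \int[vol]_t `|(q (Cn_of t))%:E|)%E).
    have I0 : (0 <= \int[vol]_t `|(q (Cn_of t))%:E|)%E by exact: integral_ge0.
    rewrite (ge0_integralZr leb measurableT mI pI I0).
    by rewrite int_indic lte_mul_pinfty// lee_fin mulr_ge0// pi_ge0.
  move=> th _.
  rewrite -(ge0_integral_isometry (g := fun z => `|(q z)%:E|%E) (isoU th) maE)//.
  have mUa : measurable_fun setT (fun t => `|(q (U th (Cn_of t)))%:E|%E).
    exact: (measurableT_comp _ (mUq th)).
  rewrite -(ge0_integralZl vol measurableT mUa (fun _ _ => abse_ge0 _) (pI I)).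
  by apply: eq_integral => t _; rewrite /k /= normrM ger0_norm.
transitivity (\int[leb]_th \int[vol]_t (k (th, t))%:E)%E; last first.
  rewrite (Fubini ik).
  by apply: eq_integral => t _; exact: int_circle.
have fin_q := integrable_fin_num measurableT iq.
rewrite -int_indic -[X in (_ * X)%E]fineK// -integralZr//; last first.
  apply/integrableP; split; first exact: mI.
  rewrite (eq_integral (fun th => (\1_D th)%:E)); first by rewrite int_indic ltry.
  by move=> th _; rewrite gee0_abs// lee_fin.
apply: eq_integral => th _; rewrite fineK//.
rewrite -(integral_isometry (g := fun z => (q z)%:E) (isoU th) mqE).
rewrite -integralZl//.
apply/integrableP; split; first exact: mUq.
by rewrite (ge0_integral_isometry (g := fun z => `|(q z)%:E|%E) (isoU th) maE).
Qed.

End averaging.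

(** * Holomorphic functions and the weight *)

Section holomorphic_theory.
Variables (R : realType) (n : nat).
Local Notation K := (R[i] : numFieldType).
Local Notation Cn := 'cV[R[i]]_n.
Local Notation KV := 'cV[R[i] : numFieldType]_n.
Local Notation normc := Normc.normc.
Implicit Types f g : Cn -> R[i].

Lemma holomorphic_eps f (z : Cn) (e : R) : holomorphic f -> 0 < e ->
  exists2 de : R, 0 < de & forall z' : Cn,
    (forall j, normc (z' j 0 - z j 0) < de) -> normc (f z' - f z) < e.
Proof.
move=> hf e0; have /differentiable_continuous cf := hf z.
have : nbhs (z : KV) [set z' : KV | normc (f z' - f z) < e].
  exact: ((cvg_normcP (F := nbhs (z : KV)) (f : KV -> K) (f z)).1 cf e e0).
move=> /nbhs_ballP[d /= d0 Hd]; move: d0 Hd; rewrite ltcE => /andP[/eqP /= Id d0] Hd.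
exists (complex.Re d) => // z' zz'; apply: Hd; split; first by rewrite ltcE Id eqxx.
move=> i j; rewrite ord1 /ball /= -/(normc _) ltcE Id eqxx /=.
by have := zz' i; rewrite -normcN opprB.
Qed.

(** Passage from several variables to one. The function [phi] is the difference quotient of the
    restriction to the line, with the derivative [l] as value at [u0]. *)
Lemma entire_line f (a b : Cn) : holomorphic f -> entire (fun u => f (a + u *: b)).
Proof.
move=> hf u0.
have dF : derivable (fun u : K => f (a + u *: b) : K) u0 1.
  apply/derivable1_diffP.
  apply: (@differentiable_comp _ _ _ _ (fun u : K => (a + u *: b) : KV) (f : KV -> K)).
    by apply: differentiableD.
  exact: hf.
pose F u := f (a + u *: b).
have [l Hl] : exists l : K, forall e : R, 0 < e -> exists2 d : R, 0 < d &
    forall h : K, normc h < d -> h != 0 ->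
      normc (h^-1 * (F (h + u0) - F u0) - l) < e.
  move/cvg_ex : dF => [/= l cl]; exists l => e e0.
  have := (cvg_normcP (F := 0^') _ (l : K)).1 cl e e0.
  rewrite near_withinE => H.
  have [d d0 Hd] := (nbhs_normcP (0 : K) _).1
    (H (within_filter _ (nbhs_filter (0 : K)))).
  exists d => // h hd h0.
  by have := Hd h; rewrite subr0 => /(_ hd h0); rewrite /GRing.scale /= mulr1.
exists (fun u => if u == u0 then l else (F u - F u0) / (u - u0)); split.
  apply/(cvg_normcP (F := nbhs (u0 : K))) => e e0; have [d d0 Hd] := Hl e e0.
  apply/nbhs_normcP; exists d => // u ud; rewrite eqxx.
  case: eqP => [_|/eqP uu0]; first by rewrite subrr Normc.normc0.
  have := Hd (u - u0) ud; rewrite subr_eq0 => /(_ uu0).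
  by rewrite subrK mulrC.
move=> u; case: eqP => [->|/eqP uu0]; first by rewrite subrr mul0r addr0.
by rewrite mulrCA mulfV ?subr_eq0// mulr1 [RHS]addrC subrK.
Qed.

Lemma holomorphic_cst (k : R[i]) : holomorphic (fun _ : Cn => k).
Proof. by move=> z; exact: (@differentiable_cst K KV K). Qed.

Lemma holomorphic_coord j : holomorphic (fun z : Cn => z j 0).
Proof. by move=> z; exact: (@differentiable_coord K n 1). Qed.

Lemma holomorphic_scale k f : holomorphic f -> holomorphic (fun z => k * f z).
Proof.
move=> hf K' z; have dz := hf z.
exact: (@differentiableZ K KV K (f : KV -> K) k z dz).
Qed.

Lemma holomorphicD f g :
  holomorphic f -> holomorphic g -> holomorphic (fun z => f z + g z).
Proof.
move=> hf hg K' z; have dz := hf z; have dz' := hg z.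
exact: (@differentiableD K KV K (f : KV -> K) (g : KV -> K) z dz dz').
Qed.

Lemma holomorphic_affine f (A : 'M[R[i]]_n) (D : Cn) : holomorphic f ->
  holomorphic (fun z => f (A *m z + D)).
Proof.
move=> hf K' z.
apply: (@differentiable_comp K KV KV K (fun z : KV => (A *m z + D) : KV) (f : KV -> K)).
  (* The linear part is written as the sum of coordinates times columns, each term being visibly
     differentiable. *)
  rewrite (_ : (fun z : KV => _) = (\sum_(j < n) (fun z : KV => z j 0 *: (col j A : KV)))
      + cst (D : KV)); last first.
    apply/funext => v; rewrite fctE fct_sumE; congr (_ + _).
    apply/matrixP => i j; rewrite ord1 mxE summxE; apply: eq_bigr => l _.
    by rewrite !mxE mulrC.
  apply: differentiableD; last exact: differentiable_cst.
  apply: differentiable_sum => j.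
  apply: (@differentiableZl K KV KV (fun v : KV => v j 0 : K)).
  exact: (@differentiable_coord K n 1).
exact: hf.
Qed.

End holomorphic_theory.

Section half_line_calculus.
Variable R : realType.
Implicit Types f : R -> R.

Lemma hl_deriv_eps f (y e : R) : hl_derivable f -> 0 <= y -> 0 < e ->
  exists2 d : R, 0 < d & forall x, 0 <= x -> `|x - y| < d -> x != y ->
    `|(f x - f y) / (x - y) - hl_deriv f y| < e.
Proof.
move=> df y0 e0; have := df y y0; rewrite -/(hl_deriv f y) => cf.
have : hl_quotient f y x @[x --> within `[0, +oo[ y^'] --> hl_deriv f y by exact: cf.
move=> /cvgrPdist_lt /(_ _ e0); rewrite !near_withinE => /nbhs_ballP[d /= d0 Hd].
exists d => // x x0 xy xny; rewrite distrC.
have yx : ball y d x by rewrite /ball /= distrC.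
by have := Hd x yx xny; apply; rewrite /= in_itv /= andbT.
Qed.

(** Half-line derivatives ignore the values of [f] on the negative reals. Extending by the constant
    [f 0] gives a function continuous on all of [R], to which the mean value theorem and
    measurability results apply. *)
Definition fcut f (x : R) := f (Num.max x 0).

Lemma fcutE f x : 0 <= x -> fcut f x = f x.
Proof. by move=> x0; rewrite /fcut max_l. Qed.

Lemma continuous_fcut f : hl_derivable f -> continuous (fcut f).
Proof.
move=> df y; pose y' := Num.max y 0.
have y'0 : 0 <= y' by rewrite le_max lexx orbT.
have [d d0 Hd] := hl_deriv_eps df y'0 ltr01.
pose K := `|hl_deriv f y'| + 1; have K0 : 0 < K by rewrite ltr_wpDl.
apply/cvgrPdist_lt => e e0; near=> x; rewrite distrC /fcut -/y'.
pose x' := Num.max x 0; rewrite -/x'.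
have x'0 : 0 <= x' by rewrite le_max lexx orbT.
have xy : `|x' - y'| <= `|x - y|.
  have b1 : x - y <= `|x - y| by exact: ler_norm.
  have b2 : y - x <= `|x - y| by rewrite distrC; exact: ler_norm.
  by rewrite /x' /y' ler_norml; have [h1|h1] := leP x 0; have [h2|h2] := leP y 0;
    apply/andP; split; lra.
have xd : `|x - y| < d by rewrite distrC; near: x; exact: cvgr_dist_lt.
have xe : `|x - y| < e / K.
  by rewrite distrC; near: x; apply: cvgr_dist_lt => //; exact: divr_gt0.
have [->|xny] := eqVneq x' y'; first by rewrite subrr normr0.
have h := Hd x' x'0 (le_lt_trans xy xd) xny.
have s0 : x' - y' != 0 by rewrite subr_eq0.
have q : `|(f x' - f y') / (x' - y')| <= K.
  rewrite -[X in `|X|](subrK (hl_deriv f y')) (le_trans (ler_normD _ _))//.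
  by rewrite addrC lerD// ltW.
rewrite -(divfK s0 (f x' - f y')) normrM.
apply: le_lt_trans (_ : K * `|x - y| < _); first exact: ler_pM.
by rewrite mulrC -ltr_pdivlMr.
Unshelve. all: by end_near. Qed.

(** Mean value theorem for [fcut f]: a point [x > 0] has a neighbourhood inside the half-line, so
    there [hl_deriv] is an ordinary derivative. *)
Lemma hl_MVT f (b : R) : hl_derivable f -> 0 < b ->
  exists2 c : R, 0 < c & f b - f 0 = hl_deriv f c * b.
Proof.
move=> df b0.
have dc (x : R) : x \in `]0, b[ -> is_derive x 1 (fcut f) (hl_deriv f x).
  rewrite in_itv /= => /andP[x0 xb]; apply/is_derive1_caratheodory.
  exists (fun z => if z == x then hl_deriv f x else (fcut f z - fcut f x) / (z - x)).
  split; last by rewrite eqxx.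
    move=> z; case: eqP => [->|/eqP zx]; first by rewrite !subrr mulr0.
    by rewrite divfK// subr_eq0.
  apply/cvgrPdist_lt => e e0; rewrite eqxx.
  have [d d0 Hd] := hl_deriv_eps df (ltW x0) e0.
  near=> z; case: eqP => [_|/eqP zx]; first by rewrite subrr normr0.
  have z0 : 0 <= z by apply/ltW; near: z; exact: lt_nbhsr.
  rewrite distrC (fcutE f z0) (fcutE f (ltW x0)); apply: (Hd z z0 _ zx).
  by rewrite distrC; near: z; exact: cvgr_dist_lt.
have [c] := MVT b0 dc (continuous_subspaceT (continuous_fcut df)).
rewrite in_itv /= => /andP[c0 cb]; rewrite (fcutE f (ltW b0)) fcutE// subr0 => E.
by exists c.
Unshelve. all: by end_near. Qed.

End half_line_calculus.

Section weight_theory.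
Variables (R : realType) (n : nat) (psi : R -> R).
Hypothesis hpsi : admissible_weight n psi.

(** The constant is [psi'(0)]: the mean value theorem for [psi'] with [psi'' >= 0] gives
    [psi' >= psi'(0)], and the one for [psi] concludes. The weight is thus bounded by a Gaussian. *)
Lemma weight_linear_growth :
  exists2 c : R, 0 < c & forall y, 0 <= y -> c * y <= psi y.
Proof.
case: hpsi => psi0 [d1 d2 _ _] d1_gt0 d2_ge0 _ _.
exists (hl_deriv psi 0); first exact: d1_gt0.
move=> y; rewrite le_eqVlt => /predU1P[<-|y0]; first by rewrite mulr0 psi0.
have [c c0 E] := hl_MVT d1 y0.
have [c' c'0 E'] := hl_MVT d2 c0.
have h : 0 <= hl_deriv (hl_deriv psi) c' by exact/d2_ge0/ltW.
have h0 : 0 <= psi 0 by exact: psi0.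
rewrite (_ : psi y = psi 0 + (psi y - psi 0)); last by rewrite addrC subrK.
rewrite E ler_wpDl// ler_pM2r// -subr_ge0 E' mulr_ge0// ltW//.
Qed.

Lemma weightE (z : 'cV[R[i]]_n) : weight psi z = expR (- fcut psi (sqn z)).
Proof. by rewrite /weight sqr_cnorm fcutE// sqn_ge0. Qed.

Lemma sqn_Cn_of t : sqn (Cn_of t : 'cV[R[i]]_n) = \sum_(i < n + n) tnth t i ^+ 2.
Proof. by rewrite sqnE Cn_ofK. Qed.

Lemma cn_measurable_weight : cn_measurable (@weight R n psi).
Proof.
rewrite /cn_measurable.
under [X in measurable_fun _ X]eq_fun do rewrite weightE sqn_Cn_of.
have c : continuous (fun x => expR (- fcut psi x)).
  move=> x; apply: continuous_comp; last exact: continuous_expR.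
  apply: continuousN; apply: continuous_fcut.
  by case: hpsi => _ [].
apply: (measurableT_comp (continuous_measurable_fun c)).
apply: measurable_sum => i.
by apply: measurable_funX; exact: measurable_tnth.
Qed.

Lemma weight_gt0 (z : 'cV[R[i]]_n) : 0 < weight psi z.
Proof. exact: expR_gt0. Qed.

Lemma weight_isometry M (z : 'cV[R[i]]_n) : Cn_isometry M ->
  weight psi (M z) = weight psi z.
Proof. by move=> [_ _ h _]; rewrite !weightE h. Qed.

End weight_theory.

Lemma eq_itv_int (R : realType) (f g : R -> R) (a b : R) :
  f =1 g -> itv_int f a b = itv_int g a b.
Proof. by move=> /funext ->. Qed.

Lemma itv_intZr (R : realType) (f : R -> R) (k a b : R) : continuous f ->
  itv_int (fun x => f x * k) a b = itv_int f a b * k.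
Proof. by move=> cf; apply: RintegralZr => //; exact: integrable_itv. Qed.

(** * Composition with Hermitian contractions *)

Section linear_isometries.
Variables (R : realType) (n : nat).
Local Notation Cn := 'cV[R[i]]_n.
Local Notation normc := Normc.normc.
Local Notation mR := (measurableTypeR R).

Lemma conj_transposeM (A B : 'M[R[i]]_n) :
  conj_transpose (A *m B) = conj_transpose B *m conj_transpose A.
Proof. by rewrite /conj_transpose trmx_mul map_mxM. Qed.

Lemma conj_transposeK : involutive (@conj_transpose R n).
Proof. by move=> A; apply/matrixP => i j; rewrite !mxE conjcK. Qed.

Lemma cdot_adjoint (A : 'M[R[i]]_n) (w z : Cn) :
  cdot (A *m w) z = cdot w (conj_transpose A *m z).
Proof.
rewrite /cdot; under eq_bigr do rewrite mxE mulr_suml.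
rewrite exchange_big /=; apply: eq_bigr => j _.
rewrite mxE conjc_sum mulr_sumr; apply: eq_bigr => k _.
by rewrite !mxE conjcM conjcK; ring.
Qed.

Lemma Cn_isometry_mx (A : 'M[R[i]]_n) : conj_transpose A *m A = 1%:M ->
  Cn_isometry (fun z : Cn => A *m z).
Proof.
move=> AA; have AA' : A *m conj_transpose A = 1%:M by exact: mulmx1C.
have mA (B : 'M[R[i]]_n) (Z : (n + n).-tuple mR -> Cn) :
    vmeasurable Z -> vmeasurable ((fun z => B *m z) \o Z).
  by move=> mZ; apply: (vmeasurable_mul (A := fun=> B)) => // i j; exact: cmeasurable_cst.
split; [by move=> x y; rewrite mulmxDr| |move=> z|exact: mA].
  exists (fun z => conj_transpose A *m z); last exact: mA.
  by move=> z; rewrite mulmxA AA' mul1mx.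
by rewrite -!Re_cdot cdot_adjoint mulmxA AA mul1mx.
Qed.

(** For an idempotent [P], the map that fixes the kernel of [P] and multiplies its range by [u]. It
    is multiplicative in [u], so [E (cis t)] and [E r] commute. *)
Definition proj_scale (P : 'M[R[i]]_n) (u : R[i]) : 'M[R[i]]_n := 1%:M + (u - 1) *: P.

Variable P : 'M[R[i]]_n.
Hypothesis P_idem : P *m P = P.
Hypothesis P_herm : conj_transpose P = P.
Local Notation E := (proj_scale P).

Lemma proj_scaleM u v : E u *m E v = E (u * v).
Proof.
rewrite /proj_scale mulmxDr !mulmxDl !mul1mx !mulmx1 -scalemxAl -scalemxAr P_idem.
rewrite scalerA -!addrA; congr (_ + _); rewrite -!scalerDl; congr (_ *: _).
by ring.
Qed.

Lemma proj_scale1 : E 1 = 1%:M.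
Proof. by rewrite /proj_scale subrr scale0r addr0. Qed.

Lemma proj_scale_conj u : conj_transpose (E u) = E (conjc u).
Proof.
apply/matrixP => i j; rewrite !mxE conjcD conjcM -[in RHS]P_herm !mxE eq_sym.
have -> : conjc (u - 1) = conjc u - 1.
  by rewrite conjcD; congr (_ + _); apply/eqP; rewrite eq_complex /= !oppr0 !eqxx.
by congr (_ + _); case: (i == j); apply/eqP; rewrite eq_complex /= oppr0 !eqxx.
Qed.

Lemma cis_conj (t : R) : conjc (cis t) * cis t = 1.
Proof.
apply/eqP; rewrite eq_complex /= mulNr opprK -!expr2 cos2Dsin2 eqxx /=.
by rewrite mulNr [sin t * _]mulrC subrr.
Qed.

Lemma Cn_isometry_circle t : Cn_isometry (fun z : Cn => E (cis t) *m z).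
Proof.
by apply: Cn_isometry_mx; rewrite proj_scale_conj proj_scaleM cis_conj proj_scale1.
Qed.

Lemma proj_scale_mul u (z : Cn) : E u *m z = (z - P *m z) + u *: (P *m z).
Proof.
rewrite /proj_scale mulmxDl mul1mx -scalemxAl scalerBl scale1r.
by rewrite addrA addrAC.
Qed.

End linear_isometries.

(** * The real inner product and symmetric compositions *)

Section fock_theory.
Variables (R : realType) (n : nat) (psi : R -> R).
Hypothesis hpsi : admissible_weight n psi.
Local Notation Cn := 'cV[R[i]]_n.
Local Notation normc := Normc.normc.
Local Notation Re := complex.Re.
Local Notation Im := complex.Im.
Local Notation mR := (measurableTypeR R).
Local Notation vol := (@lebt R (n + n)).
Local Notation w := (@weight R n psi).
Implicit Types f g h : Cn -> R[i].

Lemma eps_continuous_holomorphic f (p : R[i] -> R) : {morph p : x y / x - y} ->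
  (forall z, `|p z| <= normc z) -> holomorphic f -> eps_continuous (fun z => p (f z)).
Proof.
move=> pB ple hf z e e0; have [d d0 Hd] := holomorphic_eps z hf e0.
by exists d => // z' /Hd; apply: le_lt_trans; rewrite -pB.
Qed.

Lemma cmeasurable_holomorphic d (T : measurableType d) f (Z : T -> Cn) :
  holomorphic f -> vmeasurable Z -> cmeasurable (fun x => f (Z x)).
Proof.
move=> hf mZ; split.
  apply: (measurable_eps_continuous (g := fun z => Re (f z))) => //.
  apply: (@eps_continuous_holomorphic f (@complex.Re R)) => //.
    by case=> [? ?] [? ?].
  exact: normr_Re_le.
apply: (measurable_eps_continuous (g := fun z => Im (f z))) => //.
apply: (@eps_continuous_holomorphic f (@complex.Im R)) => //.
  by case=> [? ?] [? ?].
exact: normr_Im_le.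
Qed.

Definition pairing f h (z : Cn) : R := Re (f z * conjc (h z)) * w z.
Definition density f (z : Cn) : R := normc (f z) ^+ 2 * w z.

Lemma density_ge0 f z : 0 <= density f z.
Proof. by rewrite mulr_ge0 ?sqr_ge0// expR_ge0. Qed.

Lemma densityE f z : density f z = pairing f f z.
Proof. by rewrite /density sqr_normcE. Qed.

Lemma cn_measurable_pairing f h : holomorphic f -> holomorphic h ->
  cn_measurable (pairing f h).
Proof.
move=> hf hh; apply: measurable_realfun.measurable_funM.
  have mC : vmeasurable (@Cn_of R n) by exact: vmeasurable_Cn_of.
  by have [] := cmeasurableM (cmeasurable_holomorphic hf mC)
    (cmeasurable_conj (cmeasurable_holomorphic hh mC)).
exact: cn_measurable_weight hpsi.
Qed.

Lemma cn_measurable_density f : holomorphic f -> cn_measurable (density f).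
Proof.
move=> hf; have := cn_measurable_pairing hf hf.
by congr (measurable_fun _ _); apply/funext => t; rewrite densityE.
Qed.

Lemma fock_integrable f : fock psi f ->
  vol.-integrable setT (fun t => (density f (Cn_of t))%:E).
Proof.
move=> [hf fin]; apply/integrableP; split.
  by apply/measurable_EFinP; exact: cn_measurable_density.
under eq_integral do rewrite gee0_abs ?lee_fin ?density_ge0//.
exact: fin.
Qed.

Lemma pairing_le f h z : `|pairing f h z| <= density f z + density h z.
Proof.
rewrite /pairing /density -mulrDl normrM (ger0_norm (expR_ge0 _)).
rewrite ler_wpM2r ?expR_ge0// (le_trans (normr_Re_le _))// Normc.normcM normc_conj.
move: (normc _) (normc _) => a b.
by have := sqr_ge0 (a - b); have := sqr_ge0 a; have := sqr_ge0 b; nra.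
Qed.

Lemma integrable_pairing f h : fock psi f -> fock psi h ->
  vol.-integrable setT (fun t => (pairing f h (Cn_of t))%:E).
Proof.
move=> Ff Fh; have := integrableD measurableT (fock_integrable Ff) (fock_integrable Fh).
apply: le_integrable => //.
  by apply/measurable_EFinP; apply: cn_measurable_pairing; [case: Ff|case: Fh].
move=> t _ /=; rewrite lee_fin (le_trans (pairing_le _ _ _))// ler_norm//.
Qed.

Definition rdot f h : R := (\int[vol]_t pairing f h (Cn_of t))%R.

Lemma fock_scale (k : R[i]) f : fock psi f -> fock psi (fun z => k * f z).
Proof.
move=> Ff; have [hf _] := Ff; split; first exact: holomorphic_scale.
have := integrableZl measurableT (normc k ^+ 2) (fock_integrable Ff).
move=> /integrableP[_]; apply: le_lt_trans; apply: ge0_le_integral => //.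
- by move=> t _; rewrite lee_fin mulr_ge0 ?sqr_ge0 ?expR_ge0.
- by apply/measurable_EFinP; exact: (cn_measurable_density (holomorphic_scale k hf)).
- apply: measurableT_comp => //; apply/measurable_EFinP.
  apply: measurable_realfun.measurable_funM; first exact: measurable_cst.
  exact: (cn_measurable_density hf).
- move=> t _; rewrite -EFinM /= lee_fin ger0_norm.
    by rewrite Normc.normcM exprMn -mulrA.
  by rewrite mulr_ge0 ?sqr_ge0 ?density_ge0.
Qed.

(** Since [Im z = Re (- i z)], identities proved for the real pairing [rdot] reach the full inner
    product by applying them also to [- i f]. *)
Lemma fock_dotE f h : fock_dot psi f h = rdot f h +i* rdot (fun z => - 'i%C * f z) h.
Proof.
rewrite /fock_dot; congr (_ +i* _); apply: eq_Rintegral => t _; rewrite /pairing.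
  by case: (f _) (h _) => a b [c d] /=; rewrite mulr0 subr0.
by case: (f _) (h _) => a b [c d] /=; ring.
Qed.

Lemma rdot_isometry f h (M : Cn -> Cn) : Cn_isometry M ->
  holomorphic f -> holomorphic h ->
  rdot (f \o M) (h \o M) = rdot f h.
Proof.
move=> iM hf hh; rewrite /rdot /Rintegral; congr fine.
rewrite -(integral_isometry (g := fun z => (pairing f h z)%:E) iM).
  by apply: eq_integral => t _; rewrite /pairing /= (weight_isometry psi _ iM).
by apply/measurable_EFinP; exact: cn_measurable_pairing.
Qed.

Lemma fock_isometry f (M : Cn -> Cn) : Cn_isometry M -> holomorphic (f \o M) ->
  fock psi f -> fock psi (f \o M).
Proof.
move=> iM hfM [hf fin]; split => //.
have mf : measurable_fun setT (fun t => (density f (Cn_of t))%:E).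
  by apply/measurable_EFinP; exact: cn_measurable_density.
have pf z : (0 <= (density f z)%:E)%E by rewrite lee_fin density_ge0.
have E := ge0_integral_isometry (g := fun z => (density f z)%:E) iM mf pf.
apply: le_lt_trans fin; rewrite -[leRHS]E le_eqVlt; apply/orP; left; apply/eqP.
apply: eq_integral => t _.
by rewrite /density /= (weight_isometry psi _ iM).
Qed.

Lemma holomorphic_mul f (A : 'M[R[i]]_n) : holomorphic f -> holomorphic (fun z => f (A *m z)).
Proof.
move=> /(@holomorphic_affine R n f A 0).
by congr holomorphic; apply/funext => z; rewrite addr0.
Qed.

(** Preservation of the Fock space is included so that the property passes to products of commuting
    matrices: the symmetry of one factor is used on functions composed with the other. *)
Definition symmetric_composition (A : 'M[R[i]]_n) : Prop :=
  (forall f, fock psi f -> fock psi (fun z => f (A *m z))) /\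
  (forall f h, fock psi f -> fock psi h ->
    rdot (fun z => f (A *m z)) h = rdot f (fun z => h (A *m z))).

Lemma symmetric_composition1 : symmetric_composition 1%:M.
Proof.
have E f : (fun z => f (1%:M *m z)) = f by apply/funext => z; rewrite mul1mx.
by split => [f|f h]; rewrite !E.
Qed.

Lemma symmetric_compositionM A B : symmetric_composition A ->
  symmetric_composition B -> A *m B = B *m A -> symmetric_composition (A *m B).
Proof.
move=> [fA sA] [fB sB] AB; split => [f Ff|f h Ff Fh].
  under eq_fun do rewrite -mulmxA.
  exact: (fB _ (fA _ Ff)).
rewrite {2}AB; under eq_fun do rewrite -mulmxA.
under [X in _ = rdot _ X]eq_fun do rewrite -mulmxA.
rewrite (sB (fun z => f (A *m z)) h (fA _ Ff) Fh).
by rewrite (sA f (fun z => h (B *m z)) Ff (fB _ Fh)).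
Qed.

(** Invariance of [rdot] under [A] gives [<f o A, h> = <f o A o A, h o A>], and [A] is its own
    inverse. *)
Lemma symmetric_composition_involution (A : 'M[R[i]]_n) :
  conj_transpose A = A -> A *m A = 1%:M -> symmetric_composition A.
Proof.
move=> Ah AA; have iA : Cn_isometry (fun z : Cn => A *m z).
  by apply: Cn_isometry_mx; rewrite Ah.
split => [f Ff|f h Ff Fh].
  by apply: (fock_isometry iA) => //; apply: holomorphic_mul; case: Ff.
rewrite -(rdot_isometry iA (f := f) (h := fun z => h (A *m z))).
- by congr rdot; apply/funext => z /=; rewrite mulmxA AA mul1mx.
- by case: Ff.
- by apply: holomorphic_mul; case: Fh.
Qed.

Section projection.
Variable P : 'M[R[i]]_n.
Hypothesis P_idem : P *m P = P.
Hypothesis P_herm : conj_transpose P = P.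
Local Notation E := (proj_scale P).

Let U t (z : Cn) : Cn := E (cis t) *m z.

Let isoU t : Cn_isometry (U t). Proof. exact: Cn_isometry_circle. Qed.

Let mU : vmeasurable (fun p : mR * (n + n).-tuple mR => U p.1 (Cn_of p.2)).
Proof.
apply: (vmeasurable_mul (A := fun p : mR * (n + n).-tuple mR => E (cis p.1))).
  move=> i j; under [X in cmeasurable X]eq_fun do rewrite !mxE.
  apply: cmeasurableD; first exact: cmeasurable_cst.
  apply: cmeasurableM; last exact: cmeasurable_cst.
  apply: cmeasurableD; last exact: cmeasurable_cst.
  split.
    apply: (measurableT_comp (continuous_measurable_fun (@continuous_cos R))).
    exact: measurable_fst.
  apply: (measurableT_comp (continuous_measurable_fun (@continuous_sin R))).
  exact: measurable_fst.
move=> j; have [m1 m2] := @vmeasurable_Cn_of R n j.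
by split; [apply: (measurableT_comp m1)|apply: (measurableT_comp m2)]; exact: measurable_snd.
Qed.

Let line f (z : Cn) (u : R[i]) := f (E u *m z).

Let entire_proj f z : holomorphic f -> entire (line f z).
Proof.
move=> /(@entire_line R n f (z - P *m z) (P *m z)).
by congr entire; apply/funext => u; rewrite /line proj_scale_mul.
Qed.

Let lineU f (r : R[i]) t z : f (E r *m U t z) = line f z (r * cis t).
Proof. by rewrite /line /U mulmxA proj_scaleM. Qed.

Let weightU t z : w (U t z) = w z. Proof. exact: weight_isometry. Qed.

Let pairingU f h (r s : R[i]) t z :
  pairing (fun v => f (E r *m v)) (fun v => h (E s *m v)) (U t z) =
  Re (line f z (r * cis t) * conjc (line h z (s * cis t))) * w z.
Proof. by rewrite /pairing !lineU weightU. Qed.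

Let cont_pairingU f h (r s : R[i]) z : holomorphic f -> holomorphic h ->
  continuous (fun t => pairing (fun v => f (E r *m v)) (fun v => h (E s *m v)) (U t z)).
Proof.
move=> hf hh; rewrite (_ : (fun t => _) = fun t =>
  Re (line f z (r * cis t) * conjc (line h z (s * cis t))) * w z).
  move=> t; apply: cvgM; last exact: cvg_cst.
  by apply: continuous_circle; exact: entire_proj.
by apply/funext => t; exact: (@pairingU f h r s t z).
Qed.

(** Writing a function as its composition with [E 1] gives both sides of a comparison one shape,
    with radii [r] and [1]. *)
Let E1 f : (fun v => f (E 1 *m v)) = f.
Proof. by apply/funext => v; rewrite proj_scale1 mul1mx. Qed.

Let circle_pairing f h (r s : R[i]) z : holomorphic f -> holomorphic h ->
  itv_int (fun t => pairing (fun v => f (E r *m v)) (fun v => h (E s *m v)) (U t z)) 0 (2 * pi)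
  = itv_int (fun t => Re (line f z (r * cis t) * conjc (line h z (s * cis t)))) 0 (2 * pi)
    * w z.
Proof.
move=> hf hh; rewrite -itv_intZr; last by apply: continuous_circle; exact: entire_proj.
by apply: eq_itv_int => t; exact: (@pairingU f h r s t z).
Qed.

(** Both densities are averaged over the circle of isometries. On each orbit the weight is constant,
    and [circle_contraction] compares radius [r] with radius [1]. *)
Lemma fock_proj_scale f (r : R) : 0 <= r <= 1 -> fock psi f ->
  fock psi (fun z => f (E r%:C *m z)).
Proof.
move=> r01 Ff; have [hf fin] := Ff.
have hfr : holomorphic (fun z => f (E r%:C *m z)) by exact: holomorphic_mul.
split => //.
have p0 : 0 < 2 * pi :> R by rewrite mulr_gt0// pi_gt0.
have cd (s : R) z : continuous (fun t => density (fun v => f (E s%:C *m v)) (U t z)).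
  under [X in continuous X]eq_fun do rewrite densityE.
  exact: cont_pairingU.
have hs (s : R) : holomorphic (fun z => f (E s%:C *m z)) by exact: holomorphic_mul.
have avg (s : R) := ge0_circle_average isoU mU (cn_measurable_density (hs s)) (cd s)
  (density_ge0 _).
have le_avg : ((2 * pi)%:E * \int[vol]_t (density (fun z => f (E r%:C *m z)) (Cn_of t))%:E <=
    (2 * pi)%:E * \int[vol]_t (density (fun z => f (E 1%:C *m z)) (Cn_of t))%:E)%E.
  have mavg (s : R) := measurable_circle_average mU
    (cn_measurable_density (hs s)) (cd s) (density_ge0 _).
  refine (eq_ind_r (fun x => (x <= _)%E) _ (avg r)).
  refine (eq_ind_r (fun x => (_ <= x)%E) _ (avg 1)).
  refine (ge0_le_integral vol measurableT _ (mavg r) (mavg 1) _).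
  - by move=> t _; rewrite lee_fin; apply: Rintegral_ge0 => th _; exact: density_ge0.
  - move=> t _; rewrite lee_fin.
    have I (s : R) : itv_int (fun th => density (fun v => f (E s%:C *m v))
          (U th (Cn_of t))) 0 (2 * pi) =
        itv_int (fun th => normc (line f (Cn_of t) (s%:C * cis th)) ^+ 2) 0 (2 * pi)
          * w (Cn_of t).
      rewrite -itv_intZr; last by apply: continuous_sqr_circle; exact: entire_proj.
      apply: eq_itv_int => th.
      by rewrite /density (lineU f s%:C th (Cn_of t)) (weightU th (Cn_of t)).
    refine (eq_ind_r (fun x => x <= _) _ (I r)).
    refine (eq_ind_r (fun x => _ <= x) _ (I 1)).
    refine (ler_wpM2r (ltW (weight_gt0 _ _)) _).
    have e1 : itv_int (fun th => normc (line f (Cn_of t) (cis th)) ^+ 2) 0 (2 * pi) =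
        itv_int (fun th => normc (line f (Cn_of t) (1%:C * cis th)) ^+ 2) 0 (2 * pi).
      by apply: eq_itv_int => th; rewrite mul1r.
    refine (eq_ind _ (fun x => _ <= x) _ _ e1).
    exact: (circle_contraction (entire_proj (Cn_of t) hf) r01).
have key (x y : \bar R) : ((2 * pi)%:E * x <= (2 * pi)%:E * y)%E -> (x <= y)%E.
  by rewrite lee_pmul2l// lte_fin.
refine (le_lt_trans (key _ _ le_avg) _).
exact: (eq_ind_r (fun g => (\int[vol]_t (density g (Cn_of t))%:E < +oo)%E) fin (E1 f)).
Qed.

(** After averaging, the two integrands agree at every point: this is [circle_swap] for the two
    entire functions on the orbit, multiplied by the weight. *)
Lemma symmetric_composition_proj_scale (r : R) : 0 <= r <= 1 ->
  symmetric_composition (E r%:C).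
Proof.
move=> r01; split => [f|f h Ff Fh]; first exact: fock_proj_scale.
have [hf _] := Ff; have [hh _] := Fh.
have Ffr := fock_proj_scale r01 Ff; have Fhr := fock_proj_scale r01 Fh.
have p0 : 0 < 2 * pi :> R by rewrite mulr_gt0// pi_gt0.
have [hfr _] := Ffr; have [hhr _] := Fhr.
have c1 z := @cont_pairingU f h r%:C 1 z hf hh.
have c2 z := @cont_pairingU f h 1 r%:C z hf hh.
rewrite (E1 h) in c1; rewrite (E1 f) in c2.
have a1 := circle_average isoU mU (cn_measurable_pairing hfr hh) c1
  (integrable_pairing Ffr Fh).
have a2 := circle_average isoU mU (cn_measurable_pairing hf hhr) c2
  (integrable_pairing Ff Fhr).
have key (x y : \bar R) : ((2 * pi)%:E * x = (2 * pi)%:E * y)%E -> x = y.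
  move=> /(congr1 (fun x => ((2 * pi)^-1)%:E * x)%E).
  by rewrite !muleA -EFinM mulVf ?gt_eqF// !mul1e.
rewrite /rdot /Rintegral; congr fine; apply: key.
refine (eq_ind_r (fun x => x = _) _ a1); refine (eq_ind_r (fun x => _ = x) _ a2).
apply: eq_integral => t _; refine (congr1 EFin _).
have i1 := @circle_pairing f h r%:C 1 (Cn_of t) hf hh.
have i2 := @circle_pairing f h 1 r%:C (Cn_of t) hf hh.
refine (eq_trans (eq_itv_int _ _ _) (eq_trans i1 (esym (eq_trans (eq_itv_int _ _ _)
  (eq_trans i2 _))))).
- by move=> th; exact: (congr1 (fun g => pairing _ g _) (esym (E1 h))).
- by move=> th; exact: (congr1 (fun g => pairing g _ _) (esym (E1 f))).
apply: esym.
refine (congr1 (fun x => x * w (Cn_of t)) _).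
have := circle_swap (entire_proj (Cn_of t) hf) (entire_proj (Cn_of t) hh)
  (proj1 (andP r01)) => sw.
refine (eq_trans (eq_trans _ sw) _); apply: eq_itv_int => th; rewrite mul1r//.
Qed.

End projection.

End fock_theory.

(** * Spectral decomposition of Hermitian matrices *)

Section spectral.
Variables (R : realType) (n : nat).
Local Notation Cn := 'cV[R[i]]_n.
Local Notation normc := Normc.normc.

Lemma hermitian_spectral (A : 'M[R[i]]_n) : conj_transpose A = A ->
  exists V (d : 'rV[R[i]]_n),
    conj_transpose V *m V = 1%:M /\ A = conj_transpose V *m diag_mx d *m V.
Proof.
move=> Ah; pose K := (R[i] : numClosedFieldType).
have nA : (A : 'M[K]_n) \is normalmx.
  have E : ((A : 'M[K]_n) ^t Num.conj)%sesqui = A by exact: Ah.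
  by apply/normalmxP; rewrite E.
have /orthomx_spectralP AE := nA.
have /unitarymxP VV := @spectral_unitarymx K n A.
set V := spectralmx (A : 'M[K]_n) in AE VV.
have VV' : conj_transpose (V : 'M[R[i]]_n) *m V = 1%:M by exact: (mulmx1C VV).
have VE : invmx V = conj_transpose (V : 'M[R[i]]_n).
  have uV : V \in unitmx by exact: spectral_unit.
  by rewrite -[RHS](mulmxK uV) VV' mul1mx.
rewrite VE in AE; exists V, (spectral_diag (A : 'M[K]_n)); split; first exact: VV'.
exact: AE.
Qed.

Variable V : 'M[R[i]]_n.
Hypothesis V_unitary : conj_transpose V *m V = 1%:M.

(** The matrices diagonal in the orthonormal basis given by [V]. As [a -> G a] is an injective
    homomorphism of star-algebras, identities between them are checked entry by entry. *)
Definition diag_conj (a : 'rV[R[i]]_n) : 'M[R[i]]_n :=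
  conj_transpose V *m diag_mx a *m V.
Local Notation G := diag_conj.

Let V_unitary' : V *m conj_transpose V = 1%:M.
Proof. exact: mulmx1C. Qed.

Lemma diag_conjM a b : G a *m G b = G (\row_i (a 0 i * b 0 i)).
Proof.
rewrite /G !mulmxA -[X in X *m diag_mx b]mulmxA V_unitary' mulmx1.
congr (_ *m _); rewrite -mulmxA; congr (_ *m _).
apply/matrixP => i j; rewrite mul_diag_mx !mxE.
by case: (i == j); rewrite ?mulr1n ?mulr0n ?mulr0.
Qed.

Lemma diag_conj1 : G (const_mx 1) = 1%:M.
Proof. by rewrite /G diag_const_mx mulmx1. Qed.

Lemma diag_conjD a b : G (a + b) = G a + G b.
Proof. by rewrite /G raddfD mulmxDr mulmxDl. Qed.

Lemma diag_conjZ k a : G (k *: a) = k *: G a.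
Proof. by rewrite /G linearZ -scalemxAr -scalemxAl. Qed.

Lemma diag_conj_adj a : conj_transpose (G a) = G (\row_i conjc (a 0 i)).
Proof.
rewrite /G !conj_transposeM conj_transposeK mulmxA; congr (_ *m _ *m _).
apply/matrixP => i j; rewrite !mxE [j == i]eq_sym.
by have [->|_] := eqVneq i j; rewrite ?mulr1n ?mulr0n ?conjc0.
Qed.

Lemma diag_conj_inj a b : G a = G b -> a = b.
Proof.
move=> /(congr1 (fun X => V *m X *m conj_transpose V)).
rewrite /G !mulmxA V_unitary' !mul1mx -!mulmxA V_unitary' !mulmx1 => /matrixP E.
by apply/rowP => i; have := E i i; rewrite !mxE eqxx !mulr1n.
Qed.

Let P j := G (delta_mx 0 j).

Lemma diag_conj_proj_idem j : P j *m P j = P j.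
Proof.
rewrite diag_conjM; congr G; apply/rowP => i; rewrite !mxE eqxx /=.
by case: (i == j); rewrite ?mulr1 ?mulr0.
Qed.

Lemma diag_conj_proj_herm j : conj_transpose (P j) = P j.
Proof.
rewrite diag_conj_adj; congr G; apply/rowP => i; rewrite !mxE eqxx /=.
by case: (i == j); rewrite ?conjc1 ?conjc0.
Qed.

Lemma proj_scale_diag_conj j u :
  proj_scale (P j) u = G (\row_i (if i == j then u else 1)).
Proof.
rewrite /proj_scale -diag_conj1 -diag_conjZ -diag_conjD; congr G.
apply/rowP => i; rewrite !mxE eqxx /=; case: (i == j).
  by rewrite mulr1 addrC subrK.
by rewrite mulr0 addr0.
Qed.

(** [z] is the unit eigenvector of [G a] for the eigenvalue [a 0 j]. *)
Lemma sqn_diag_conj_mul a j :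
  let z : Cn := conj_transpose V *m delta_mx j 0 in
  sqn z = 1 /\ sqn (G a *m z) = normc (a 0 j) ^+ 2.
Proof.
move=> z.
have iV : Cn_isometry (fun z : Cn => conj_transpose V *m z).
  by apply: Cn_isometry_mx; rewrite conj_transposeK.
have sqnZ (k : R[i]) : sqn (k *: (delta_mx j 0 : Cn)) = normc k ^+ 2.
  rewrite /sqn (bigD1 j)//= big1 ?addr0.
    by rewrite !mxE !eqxx mulr1.
  by move=> i ij; rewrite !mxE (negbTE ij) mulr0 Normc.normc0 expr0n.
split.
  by rewrite (isometry_sqn iV) -[delta_mx j 0]scale1r sqnZ Normc.normc1 expr1n.
have -> : G a *m z = conj_transpose V *m (a 0 j *: (delta_mx j 0 : Cn)).
  rewrite /G /z mulmxA -[_ *m V *m _]mulmxA V_unitary' mulmx1 -mulmxA.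
  congr (_ *m _); apply/matrixP => i k; rewrite mul_diag_mx !mxE.
  by have [->|_] := eqVneq i j; rewrite ?mulr0.
by rewrite (isometry_sqn iV) sqnZ.
Qed.

(** A crude bound whose purpose is to show that the set in [opnorm] is bounded above, so that its
    [sup] dominates its elements. *)
Lemma sqn_mulmx_diag_conj a (z : Cn) :
  sqn (G a *m z) <= (\sum_i normc (a 0 i) ^+ 2) * sqn z.
Proof.
have iV : Cn_isometry (fun z : Cn => V *m z) by exact: Cn_isometry_mx.
have iV' : Cn_isometry (fun z : Cn => conj_transpose V *m z).
  by apply: Cn_isometry_mx; rewrite conj_transposeK.
rewrite /G -!mulmxA (isometry_sqn iV') -(isometry_sqn iV z).
move: (V *m z) => {}z; rewrite [X in _ <= _ * X]/sqn mulr_sumr; apply: ler_sum => i _.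
rewrite mul_diag_mx mxE Normc.normcM exprMn ler_wpM2r ?sqr_ge0//.
by rewrite (bigD1 i)//= lerDl sumr_ge0// => k _; exact: sqr_ge0.
Qed.

Lemma opnorm_diag_conj a j : opnorm (G a) <= 1 -> normc (a 0 j) <= 1.
Proof.
move=> h; have [z1 Gz] := sqn_diag_conj_mul a j.
set z := conj_transpose V *m _ in z1 Gz.
have cn (v : Cn) : cnorm v = Num.sqrt (sqn v) by rewrite /cnorm Re_cdot.
have -> : normc (a 0 j) = cnorm (G a *m z).
  by rewrite cn Gz sqrtr_sqr ger0_norm// normc_ge0.
apply: le_trans h; apply: ub_le_sup; last first.
  by exists z => //=; rewrite cn z1 sqrtr1.
exists (Num.sqrt (\sum_i normc (a 0 i) ^+ 2)) => _ [v /= v1 <-].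
rewrite cn ler_wsqrtr// (le_trans (sqn_mulmx_diag_conj _ _))//.
rewrite ler_piMr ?sumr_ge0// => [i _|]; first exact: sqr_ge0.
by rewrite -sqr_cnorm expr_le1 ?sqrtr_ge0.
Qed.

End spectral.

Section self_adjoint_of_hermitian.
Variables (R : realType) (n : nat) (psi : R -> R).
Hypothesis hpsi : admissible_weight n psi.

(** For [r < 0], [E r = E (-1) * E (- r)]: a reflection, which is a Hermitian involution, times a
    scaling with ratio in [[0, 1]]. *)
Lemma symmetric_composition_real_scale (P : 'M[R[i]]_n) (r : R) :
  P *m P = P -> conj_transpose P = P -> `|r| <= 1 ->
  symmetric_composition psi (proj_scale P r%:C).
Proof.
move=> PP Ph; rewrite ler_norml => /andP[r1 r2].
have [r0|r0] := leP 0 r.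
  by apply: (symmetric_composition_proj_scale hpsi) => //; rewrite r0.
have mr : 0 <= - r <= 1 by apply/andP; split; lra.
have -> : r%:C = (-1)%:C * (- r)%:C by rewrite -real_complexM mulN1r opprK.
have conjR (x : R) : conjc x%:C = x%:C by rewrite conjc_real.
rewrite -proj_scaleM//; apply: symmetric_compositionM.
- apply: (symmetric_composition_involution hpsi).
    by rewrite (proj_scale_conj Ph) conjR.
  by rewrite proj_scaleM// -real_complexM mulrNN mulr1 proj_scale1.
- exact: (symmetric_composition_proj_scale hpsi).
- by rewrite (proj_scaleM PP (-1)%:C) (proj_scaleM PP (- r)%:C) [in RHS]mulrC.
Qed.

Lemma symmetric_composition_hermitian (A : 'M[R[i]]_n) :
  conj_transpose A = A -> opnorm A <= 1 -> symmetric_composition psi A.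
Proof.
move=> Ah; have [V [d [VV AE]]] := hermitian_spectral Ah.
rewrite -/(diag_conj V d) in AE.
move=> A1; rewrite AE in A1; have d1 j := opnorm_diag_conj VV j A1.
(* The eigenvalues are real: [A^* = A] identifies [G] of the conjugate diagonal with [G d], and [G]
   is injective. *)
have dr j : d 0 j = (complex.Re (d 0 j))%:C.
  have : diag_conj V (\row_i conjc (d 0 i)) = diag_conj V d.
    by rewrite -diag_conj_adj -AE.
  move=> /(diag_conj_inj VV) /rowP /(_ j); rewrite mxE.
  case: (d 0 j) => x y [] /= => /eqP; rewrite eq_sym -subr_eq0 opprK -mulr2n mulrn_eq0 /=.
  by move=> /eqP ->.
(* The first [k] eigenvalues are in place and the others are still [1]. Thus [a 0] gives the
   identity, [a n] is [d], and passing from [k] to [k + 1] multiplies by one [proj_scale]. *)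
pose a k : 'rV[R[i]]_n := \row_i (if (i < k)%N then d 0 i else 1).
have step k : (k <= n)%N -> symmetric_composition psi (diag_conj V (a k)).
  elim: k => [_|k IH kn].
    rewrite (_ : a 0 = const_mx 1); last by apply/rowP => i; rewrite !mxE ltn0.
    by rewrite (diag_conj1 VV); exact: symmetric_composition1.
  pose j := Ordinal kn.
  have E : diag_conj V (a k.+1) = diag_conj V (a k) *m
      proj_scale (diag_conj V (delta_mx 0 j)) (complex.Re (d 0 j))%:C.
    rewrite (proj_scale_diag_conj VV) (diag_conjM VV); congr diag_conj.
    apply/rowP => i; rewrite !mxE -dr ltnS leq_eqVlt -[i == j]/(i == k :> nat).
    by case: eqP => [ik|_] /=; rewrite ?mulr1// ik ltnn mul1r; congr (d 0 _); apply: val_inj.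
  rewrite E; apply: symmetric_compositionM.
  - exact/IH/ltnW.
  - apply: symmetric_composition_real_scale.
    + exact: diag_conj_proj_idem.
    + exact: diag_conj_proj_herm.
    + by rewrite -normc_real -dr.
  - rewrite (proj_scale_diag_conj VV) !(diag_conjM VV); congr diag_conj.
    by apply/rowP => i; rewrite !mxE mulrC.
rewrite AE (_ : d = a n); first exact: step.
by apply/rowP => i; rewrite mxE ltn_ord.
Qed.

Lemma fock_dot_symmetric (A : 'M[R[i]]_n) f h : symmetric_composition psi A ->
  fock psi f -> fock psi h ->
  fock_dot psi (fun z => f (A *m z)) h = fock_dot psi f (fun z => h (A *m z)).
Proof.
move=> [_ sA] Ff Fh; rewrite !fock_dotE sA//; congr (_ +i* _).
exact: (sA (fun z => - 'i%C * f z) h (fock_scale hpsi _ Ff) Fh).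
Qed.

End self_adjoint_of_hermitian.

(** * Constants and coordinate functions *)

Section gaussian_bound.
Variable R : realType.
Local Notation mR := (measurableTypeR R).
Local Notation leb := (@lebesgue_measure R).

Lemma integral_expR_sqr (c : R) : 0 < c ->
  exists k : R, (\int[leb]_x (expR (- (c * x ^+ 2)))%:E = k%:E)%E.
Proof.
(* The standard deviation with [2 s^2 = 1 / c], which makes the integrand a multiple of a normal
   density. *)
move=> c0; pose s : R := Num.sqrt (2 * c)^-1.
have c2 : 0 < (2 * c)^-1 by rewrite invr_gt0 mulr_gt0.
have s0 : 0 < s by rewrite sqrtr_gt0.
have sE : s ^+ 2 *+ 2 = c^-1.
  by rewrite sqr_sqrtr ?ltW// -mulr_natl invfM mulrA mulfV ?mul1r// gt_eqF.
exists (normal_peak s)^-1.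
have pk : 0 < normal_peak s by rewrite normal_peak_gt0// gt_eqF.
have E x : (expR (- (c * x ^+ 2)))%:E = (((normal_peak s)^-1)%R%:E * (normal_pdf 0 s x)%:E)%E.
  rewrite normal_pdfE ?gt_eqF// /normal_fun subr0 sE -EFinM.
  by rewrite mulKf ?gt_eqF// invrK mulNr [c * _]mulrC.
under eq_integral do rewrite E.
rewrite ge0_integralZl//.
- by rewrite integral_normal_pdf mule1.
- by apply/measurable_EFinP; exact: measurable_normal_pdf.
- by move=> x _; rewrite lee_fin normal_pdf_ge0.
- by rewrite lee_fin invr_ge0 ltW.
Qed.

Lemma integral_expR_sum_sqr m (c : R) : 0 < c ->
  (\int[@lebt R m]_t (expR (- (c * \sum_(i < m) tnth t i ^+ 2)))%:E < +oo)%E.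
Proof.
move=> c0; have [k kE] := integral_expR_sqr c0.
have mh : measurable_fun setT (fun x : mR => expR (- (c * x ^+ 2)) : R).
  apply: continuous_measurable_fun => x.
  apply: continuous_comp; last exact: continuous_expR.
  apply: continuousN; apply: continuousM; first exact: cst_continuous.
  exact: exprn_continuous.
have := integral_lebt_prod m mh (fun x => expR_ge0 _) kE.
under eq_integral do rewrite -expR_sum sumrN -mulr_sumr.
by move=> ->; rewrite ltry.
Qed.

End gaussian_bound.

(** * Inner products of constants and coordinate functions *)

Section fock_polynomials.
Variables (R : realType) (n : nat) (psi : R -> R).
Hypothesis hpsi : admissible_weight n psi.
Local Notation Cn := 'cV[R[i]]_n.
Local Notation normc := Normc.normc.
Local Notation Re := complex.Re.
Local Notation Im := complex.Im.
Local Notation mR := (measurableTypeR R).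
Local Notation vol := (@lebt R (n + n)).
Local Notation w := (@weight R n psi).
Implicit Types f g h : Cn -> R[i].

(** With [s = sqn z] and [psi s >= c s], the weight is at most [exp (- c s)]. One half of the
    exponent absorbs the growth, by [1 + s <= (1 + 2 / c) exp (c s / 2)]; the other half is an
    integrable Gaussian. *)
Lemma fock_quadratic_growth f (k : R) : holomorphic f ->
  (forall z, normc (f z) ^+ 2 <= k * (1 + sqn z)) -> fock psi f.
Proof.
move=> hf fk; have [c c0 psic] := weight_linear_growth hpsi.
have k0 : 0 <= k.
  have := fk 0; rewrite (_ : sqn 0 = 0 :> R); last first.
    by rewrite /sqn big1// => i _; rewrite mxE Normc.normc0 expr0n.
  by rewrite addr0 mulr1; apply: le_trans; exact: sqr_ge0.
split => //; pose e (x : R) := expR (- (c / 2 * x)).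
have c2 : 0 < c / 2 by rewrite divr_gt0.
have bound z : density psi f z <= (k * (1 + 2 / c)) * e (sqn z).
  have s0 := sqn_ge0 z.
  have wz : w z <= e (sqn z) * e (sqn z).
    rewrite /e -expRD /weight sqr_cnorm ler_expR.
    by have := psic _ s0; lra.
  have e1 : (1 + sqn z) * e (sqn z) <= 1 + 2 / c.
    have ee : e (sqn z) = (expR (c / 2 * sqn z))^-1 by rewrite /e expRN.
    rewrite ee ler_pdivrMr ?expR_gt0//.
    have h1 := expR_ge1Dx (c / 2 * sqn z).
    have h2 : 1 <= expR (c / 2 * sqn z).
      by apply: le_trans h1; rewrite lerDl mulr_ge0// ltW.
    have h3 : sqn z = 2 / c * (c / 2 * sqn z) by field; rewrite gt_eqF.
    have c3 : 0 < 2 / c by rewrite divr_gt0.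
    rewrite mulrDl mul1r {1}h3; apply: lerD => //; rewrite ler_pM2l//.
    by apply: le_trans h1; rewrite lerDr.
  apply: (le_trans (ler_pM (sqr_ge0 _) (expR_ge0 _) (fk z) wz)).
  have -> : k * (1 + sqn z) * (e (sqn z) * e (sqn z)) =
    k * ((1 + sqn z) * e (sqn z)) * e (sqn z) by ring.
  by apply: ler_wpM2r; [exact: expR_ge0|exact: ler_wpM2l].
have fin := integral_expR_sum_sqr (n + n) c2.
have me : measurable_fun setT (fun t : (n + n).-tuple mR => (e (sqn (Cn_of t : Cn)))%:E).
  apply/measurable_EFinP; rewrite /e.
  under [X in measurable_fun _ X]eq_fun do rewrite sqn_Cn_of.
  apply: (measurableT_comp (@measurable_expR R)).
  apply: measurable_realfun.measurable_funN; apply: measurable_realfun.measurable_funM.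
    exact: measurable_cst.
  apply: measurable_sum => i; apply: measurable_funX; exact: measurable_tnth.
have K0 : 0 <= k * (1 + 2 / c) by rewrite mulr_ge0// addr_ge0// divr_ge0// ltW.
have p1 t : setT t -> (0 <= (density psi f (Cn_of t))%:E)%E.
  by move=> _; rewrite lee_fin density_ge0.
have m1 : measurable_fun setT (fun t => (density psi f (Cn_of t))%:E).
  by apply/measurable_EFinP; exact: cn_measurable_density.
have m2 : measurable_fun setT (fun t : (n + n).-tuple mR =>
    ((k * (1 + 2 / c))%:E * (e (sqn (Cn_of t : Cn)))%:E)%E).
  by apply: emeasurable_funM => //; exact: measurable_cst.
have le12 t : setT t -> ((density psi f (Cn_of t))%:E <=
    (k * (1 + 2 / c))%:E * (e (sqn (Cn_of t : Cn)))%:E)%E.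
  by move=> _; rewrite -EFinM lee_fin; exact: bound.
refine (le_lt_trans (ge0_le_integral vol measurableT p1 m1 m2 le12) _).
have p2 t : setT t -> (0 <= (e (sqn (Cn_of t : Cn)))%:E)%E.
  by move=> _; rewrite lee_fin expR_ge0.
rewrite (ge0_integralZl vol measurableT me p2); last by rewrite lee_fin.
have fin' : (\int[vol]_t (e (sqn (Cn_of t : Cn)))%:E < +oo)%E.
  by under eq_integral do rewrite /e sqn_Cn_of.
rewrite lte_mul_pinfty// ?lee_fin// ge0_fin_numE//.
Qed.

Definition crd (j : 'I_n) (z : Cn) : R[i] := z j 0.
Definition one (z : Cn) : R[i] := 1.

Lemma fock_crd j : fock psi (crd j).
Proof.
apply: (@fock_quadratic_growth _ 1); first exact: holomorphic_coord.
move=> z; rewrite mul1r /sqn (bigD1 j)//= addrCA lerDl addr_ge0// sumr_ge0// => i _.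
exact: sqr_ge0.
Qed.

Lemma fock_one : fock psi one.
Proof.
apply: (@fock_quadratic_growth _ 1); first exact: holomorphic_cst.
by move=> z; rewrite Normc.normc1 expr1n mul1r lerDl sqn_ge0.
Qed.

Lemma fockD f g : fock psi f -> fock psi g -> fock psi (fun z => f z + g z).
Proof.
move=> Ff Fg; have [hf _] := Ff; have [hg _] := Fg.
have hfg := holomorphicD hf hg.
split => //.
have := integrableZl measurableT 2 (integrableD measurableT (fock_integrable hpsi Ff)
  (fock_integrable hpsi Fg)).
move=> /integrableP[mi]; apply: le_lt_trans.
have p1 t : setT t -> (0 <= (density psi (fun z => f z + g z) (Cn_of t))%:E)%E.
  by move=> _; rewrite lee_fin density_ge0.
have m1 : measurable_fun setT (fun t => (density psi (fun z => f z + g z) (Cn_of t))%:E).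
  by apply/measurable_EFinP; exact: cn_measurable_density.
have m2 : measurable_fun setT (fun t : (n + n).-tuple mR =>
    `|2 * ((density psi f (Cn_of t))%:E + (density psi g (Cn_of t))%:E)|)%E.
  exact: measurableT_comp.
refine (ge0_le_integral vol measurableT p1 m1 m2 _).
move=> t _ /=; rewrite lee_fin ger0_norm; last first.
  by rewrite mulr_ge0// addr_ge0// density_ge0.
rewrite /density -mulrDl mulrA ler_wpM2r ?expR_ge0//.
have := le_normcD (f (Cn_of t)) (g (Cn_of t)).
have := normc_ge0 (f (Cn_of t) + g (Cn_of t)).
move: (normc _) (normc (f _)) (normc (g _)) => a b c a0 abc.
rewrite (@le_trans _ _ ((b + c) ^+ 2))//; first by rewrite ler_sqr ?nnegrE// (le_trans a0).
by have := sqr_ge0 (b - c); lra.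
Qed.

Lemma fock_sum (I : Type) (r : seq I) (a : I -> R[i]) (F : I -> Cn -> R[i]) :
  (forall i, fock psi (F i)) -> fock psi (fun z => \sum_(i <- r) a i * F i z).
Proof.
move=> FF; elim: r => [|i r IH].
  have := fock_scale hpsi 0 fock_one.
  by congr fock; apply/funext => z; rewrite big_nil mul0r.
have := fockD (fock_scale hpsi (a i) (FF i)) IH.
by congr fock; apply/funext => z; rewrite big_cons.
Qed.

Local Notation dot := (@fock_dot R n psi).

Lemma rdotDl f g h : fock psi f -> fock psi g -> fock psi h ->
  rdot psi (fun z => f z + g z) h = rdot psi f h + rdot psi g h.
Proof.
move=> Ff Fg Fh; rewrite /rdot -RintegralD//; try exact: integrable_pairing.
by apply: eq_Rintegral => t _; rewrite /pairing mulrDl raddfD mulrDl.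
Qed.

Lemma fock_dotDl f g h : fock psi f -> fock psi g -> fock psi h ->
  dot (fun z => f z + g z) h = dot f h + dot g h.
Proof.
move=> Ff Fg Fh; rewrite !fock_dotE rdotDl//.
have -> : (fun z => - 'i%C * (f z + g z)) = (fun z => - 'i%C * f z + - 'i%C * g z).
  by apply/funext => z; rewrite mulrDr.
by rewrite (rdotDl (fock_scale hpsi (- 'i%C) Ff) (fock_scale hpsi (- 'i%C) Fg) Fh).
Qed.

Lemma rdotZl (k : R[i]) f h : fock psi f -> fock psi h ->
  rdot psi (fun z => k * f z) h = Re (k * dot f h).
Proof.
move=> Ff Fh; case: k => a b; rewrite fock_dotE /= /rdot.
have Fi : fock psi (fun z => - 'i%C * f z) by exact: (fock_scale hpsi _ Ff).
have i1 := integrable_pairing hpsi Ff Fh; have i2 := integrable_pairing hpsi Fi Fh.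
rewrite -RintegralZl// -RintegralZl// -RintegralB//; last 2 first.
- by have := integrableZl measurableT a i1.
- by have := integrableZl measurableT b i2.
apply: eq_Rintegral => t _; rewrite /pairing.
by case: (f _) (h _) => x y [x' y'] /=; ring.
Qed.

Lemma fock_dotZl (k : R[i]) f h : fock psi f -> fock psi h ->
  dot (fun z => k * f z) h = k * dot f h.
Proof.
move=> Ff Fh; rewrite [LHS]fock_dotE rdotZl//.
have -> : (fun z => - 'i%C * (k * f z)) = (fun z => (- 'i%C * k) * f z).
  by apply/funext => z; rewrite mulrA.
rewrite rdotZl// -mulrA; case: (k * _) => a b.
by apply/eqP; rewrite eq_complex /= eqxx /=; apply/eqP; ring.
Qed.

Lemma fock_dot_suml (I : Type) (r : seq I) (a : I -> R[i]) (F : I -> Cn -> R[i]) h :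
  (forall i, fock psi (F i)) -> fock psi h ->
  dot (fun z => \sum_(i <- r) a i * F i z) h = \sum_(i <- r) a i * dot (F i) h.
Proof.
move=> FF Fh; elim: r => [|i r IH].
  have -> : (fun z => \sum_(i <- [::]) a i * F i z) = (fun z => 0 * one z).
    by apply/funext => z; rewrite big_nil mul0r.
  by rewrite big_nil (fock_dotZl 0 fock_one Fh) mul0r.
have -> : (fun z => \sum_(j <- i :: r) a j * F j z) =
    (fun z => a i * F i z + \sum_(j <- r) a j * F j z).
  by apply/funext => z; rewrite big_cons.
rewrite (fock_dotDl (fock_scale hpsi (a i) (FF i)) (fock_sum r a FF) Fh).
by rewrite IH (fock_dotZl _ (FF i) Fh) big_cons.
Qed.

Lemma fock_dot_conj f h : fock psi f -> fock psi h -> dot h f = conjc (dot f h).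
Proof.
move=> Ff Fh; rewrite !fock_dotE /=; congr (_ +i* _).
  apply: eq_Rintegral => t _; rewrite /pairing; congr (_ * _).
  by case: (f _) (h _) => x y [x' y'] /=; ring.
have i2 := integrable_pairing hpsi (fock_scale hpsi (- 'i%C) Ff) Fh.
rewrite /rdot -[RHS]mulN1r -RintegralZl//.
apply: eq_Rintegral => t _; rewrite /pairing.
by case: (f _) (h _) => x y [x' y'] /=; ring.
Qed.

Lemma fock_dot_isometry f h (M : Cn -> Cn) : Cn_isometry M ->
  holomorphic f -> holomorphic h -> dot (f \o M) (h \o M) = dot f h.
Proof.
move=> iM hf hh; rewrite !fock_dotE (rdot_isometry hpsi iM hf hh); congr (_ +i* _).
exact: (rdot_isometry hpsi iM (holomorphic_scale (- 'i%C) hf) hh).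
Qed.

Definition flip_mx (j : 'I_n) : 'M[R[i]]_n := diag_mx (\row_k (if k == j then -1 else 1)).

Lemma flip_mul j (z : Cn) k : (flip_mx j *m z) k 0 = (if k == j then -1 else 1) * z k 0.
Proof. by rewrite mul_diag_mx !mxE. Qed.

Lemma Cn_isometry_flip j : Cn_isometry (fun z : Cn => flip_mx j *m z).
Proof.
apply: Cn_isometry_mx; apply/matrixP => i k; rewrite mxE (bigD1 i)//= big1 => [|l li].
  rewrite !mxE eqxx mulr1n addr0; have [_|_] := eqVneq i k; last by rewrite !mulr0n mulr0.
  by rewrite !mulr1n; case: (i == j); apply/eqP; rewrite eq_complex /=; apply/andP; split;
    apply/eqP; ring.
by rewrite !mxE (negbTE li) mulr0n conjc0 mul0r.
Qed.

Lemma Cn_isometry_perm (s : {perm 'I_n}) : Cn_isometry (fun z : Cn => row_perm s z).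
Proof.
have -> : (fun z : Cn => row_perm s z) = (fun z => perm_mx s *m z).
  by apply/funext => z; rewrite row_permE.
apply: Cn_isometry_mx.
by rewrite /conj_transpose tr_perm_mx map_perm_mx -perm_mxM mulVg perm_mx1.
Qed.

Lemma eq_oppc_eq0 (x : R[i]) : - x = x -> x = 0.
Proof.
by case: x => a b [] ha hb; congr (_ +i* _); lra.
Qed.

Lemma fock_dot_crd_one j : dot (crd j) one = 0.
Proof.
apply: eq_oppc_eq0; have [hc _] := fock_crd j; have [h1 _] := fock_one.
rewrite -[RHS](fock_dot_isometry (Cn_isometry_flip j) hc h1).
rewrite -[LHS]mulN1r -[LHS](fock_dotZl _ (fock_crd j) fock_one); congr fock_dot.
by apply/funext => z; rewrite /crd /= flip_mul eqxx.
Qed.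

Lemma fock_dot_crd_crd j k : j != k -> dot (crd j) (crd k) = 0.
Proof.
move=> jk; apply: eq_oppc_eq0; have [hc _] := fock_crd j; have [hk _] := fock_crd k.
rewrite -[RHS](fock_dot_isometry (Cn_isometry_flip j) hc hk).
rewrite -[LHS]mulN1r -[LHS](fock_dotZl _ (fock_crd j) (fock_crd k)); congr fock_dot.
  by apply/funext => z; rewrite /crd /= flip_mul eqxx.
by apply/funext => z; rewrite /crd /= flip_mul eq_sym (negbTE jk) mul1r.
Qed.

Lemma fock_dot_crd_sqr j k : dot (crd j) (crd j) = dot (crd k) (crd k).
Proof.
have [hk _] := fock_crd k.
rewrite -(fock_dot_isometry (Cn_isometry_perm (tperm j k)) hk hk).
by congr fock_dot; apply/funext => z; rewrite /crd /= mxE tpermR.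
Qed.

(** A vanishing norm makes the density zero almost everywhere, which is impossible for a function
    without zeros on a cube of measure [1]. The interval [[1, 2]] avoids [0], so that coordinate
    functions qualify. *)
Lemma fock_dot_neq0 f : fock psi f ->
  (forall t, (forall i, 1 <= tnth t i <= 2) -> f (Cn_of t) != 0) -> dot f f != 0.
Proof.
move=> Ff f0; apply/eqP => ff0; suff /eqP : 1 = 0 :> R by rewrite oner_eq0.
have i1 := fock_integrable hpsi Ff; have [hf _] := Ff.
move: ff0; rewrite fock_dotE => -[r0 _].
have d0 : (\int[vol]_t `|(density psi f (Cn_of t))%:E| = 0)%E.
  under eq_integral do rewrite gee0_abs ?lee_fin ?density_ge0//.
  rewrite -(fineK (integrable_fin_num measurableT i1)); congr EFin.
  by rewrite -[RHS]r0 /rdot; apply: eq_Rintegral => t _; rewrite densityE.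
have mi : measurable_fun setT (fun t => (density psi f (Cn_of t))%:E).
  by apply/measurable_EFinP; exact: cn_measurable_density.
have /(ae_eq_integral_abs vol measurableT mi) ae0 := d0.
pose b (x : mR) : R := \1_(`[1, 2]%classic : set R) x.
have mb : measurable_fun setT b by exact: measurable_indic.
have b0 x : 0 <= b x by rewrite /b indicE.
have b1 : (\int[@lebesgue_measure R]_x (b x)%:E = 1%:E)%E.
  rewrite integral_indic// setIT.
  refine (eq_trans (lebesgue_measure_itv (Interval (BLeft 1) (BRight 2))) _).
  rewrite /= lte_fin ltr1n -EFinB; congr EFin; lra.
have := integral_lebt_prod (n + n) mb b0 b1.
rewrite expr1n.
have -> : (\int[vol]_t (\prod_(i < n + n) b (tnth t i))%:E = \int[vol]_t 0)%E.
  apply: ae_eq_integral => //.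
    by apply/measurable_EFinP; exact: measurable_prod_tnth.
  apply: filterS ae0 => t /= /(_ I) [E] _; congr EFin.
  apply/eqP; apply: contraT => /prodf_neq0 H.
  have : f (Cn_of t) != 0.
    apply: f0 => i; have := H i isT; rewrite /b indicE.
    by rewrite pnatr_eq0 eqb0 negbK => /set_mem; rewrite /= in_itv.
  move: E; rewrite /density => /eqP; rewrite mulf_eq0 (gt_eqF (weight_gt0 _ _)) orbF sqrf_eq0.
  by move=> /eqP /Normc.eq0_normc ->; rewrite eqxx.
by rewrite integral0 => -[] ->.
Qed.

Lemma fock_dot_one_neq0 : dot one one != 0.
Proof. by apply: (fock_dot_neq0 fock_one) => t _; exact: oner_neq0. Qed.

Lemma fock_dot_crd_neq0 j : dot (crd j) (crd j) != 0.
Proof.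
apply: (fock_dot_neq0 (fock_crd j)) => t /(_ (lshift n j)) /andP[t1 _].
rewrite /crd mxE eq_complex /= negb_and; apply/orP; left.
by rewrite gt_eqF// (lt_le_trans _ t1).
Qed.

(** Against [one], the image of [crd j] yields [D j 0 * dot one one], whereas [one] is fixed by
    composition and orthogonal to [crd j]. Against [crd k], it yields [C j k * dot (crd k) (crd k)],
    equal to the conjugate of [C k j] times [dot (crd j) (crd j)]; these norms coincide and are
    nonzero, so they cancel. *)
Lemma hermitian_of_self_adjoint (C : 'M[R[i]]_n) (D : Cn) :
  (forall g h, fock psi g -> fock psi h ->
    dot (fun z => g (C *m z + D)) h = dot g (fun z => h (C *m z + D))) ->
  D = 0 /\ conj_transpose C = C.
Proof.
move=> sa.
have crdE j : (fun z => crd j (C *m z + D)) =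
    (fun z => \sum_k C j k * crd k z + D j 0 * one z).
  by apply/funext => z; rewrite /crd /one !mxE mulr1.
have Fs j : fock psi (fun z => \sum_k C j k * crd k z).
  by apply: fock_sum => k; exact: fock_crd.
have F1 j : fock psi (fun z => D j 0 * one z) by exact: (fock_scale hpsi _ fock_one).
have dotE j h : fock psi h -> dot (fun z => crd j (C *m z + D)) h =
    \sum_k C j k * dot (crd k) h + D j 0 * dot one h.
  move=> Fh; rewrite crdE (fock_dotDl (Fs j) (F1 j) Fh) (fock_dotZl _ fock_one Fh).
  by rewrite fock_dot_suml// => k; exact: fock_crd.
split.
  apply/matrixP => j l; rewrite ord1 mxE.
  have := sa (crd j) one (fock_crd j) fock_one.
  rewrite dotE; last exact: fock_one.
  rewrite big1 => [|k _]; last by rewrite fock_dot_crd_one mulr0.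
  rewrite add0r [X in _ = X](fock_dot_crd_one j) => /eqP.
  by rewrite mulf_eq0 (negbTE fock_dot_one_neq0) orbF => /eqP.
have dot_col j k : dot (fun z => crd j (C *m z + D)) (crd k) = C j k * dot (crd k) (crd k).
  rewrite dotE; last exact: fock_crd.
  rewrite (bigD1 k)//= big1 => [|l lk]; last by rewrite fock_dot_crd_crd// mulr0.
  have -> : dot one (crd k) = 0.
    by rewrite (fock_dot_conj (fock_crd k) fock_one) fock_dot_crd_one conjc0.
  by rewrite mulr0 !addr0.
apply/matrixP => j k; rewrite !mxE.
have := sa (crd j) (crd k) (fock_crd j) (fock_crd k).
have FC : fock psi (fun z => crd k (C *m z + D)) by rewrite crdE; exact: fockD.
rewrite dot_col (fock_dot_conj FC (fock_crd j)) dot_col conjcM.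
rewrite -(fock_dot_conj (fock_crd j) (fock_crd j)).
by rewrite (fock_dot_crd_sqr k j) => /(mulIf (fock_dot_crd_neq0 j)) ->.
Qed.

End fock_polynomials.

Theorem corollary2p2 (R : realType) (n : nat) (hn : (1 <= n)%N)
  (psi : R -> R) (hpsi : admissible_weight n psi)
  (C : 'M[R[i]]_n) (D : 'cV[R[i]]_n) (hC : opnorm C <= 1)
  (hbounded : bounded_operator psi
     (composition_operator (fun z : 'cV[R[i]]_n => C *m z + D))) :
  self_adjoint psi
    (composition_operator (fun z : 'cV[R[i]]_n => C *m z + D)) <->
  D = 0 /\ conj_transpose C = C.
Proof.
split=> [[_ _ sa]|[D0 Ch]]; first exact: (hermitian_of_self_adjoint hpsi sa).
(* Both boundedness clauses are [hbounded]; the identity between inner products is what remains. *)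
split=> // g h Fg Fh.
have := fock_dot_symmetric hpsi (symmetric_composition_hermitian hpsi Ch hC) Fg Fh.
have E f : composition_operator (fun z => C *m z + D) f = (fun z => f (C *m z)).
  by apply/funext => z; rewrite /composition_operator /= D0 addr0.
by rewrite !E.
Qed.
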